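(* Let $0<p\le 1$. Let $\{b_\varepsilon\}_{\varepsilon>0}\subseteq L^1([-\frac{\pi}{2},\frac{\pi}{2}])$ be a grazing collision family (definition in the context: properties (a), (b), (c)). Let $f_0\ge 0$ be an even function on $\mathbb{R}$ with $\int_{\mathbb{R}} f_0(v)\,dv=1$, and for each $\varepsilon>0$ let $f_\varepsilon\in C^1([0,+\infty),L^1(\mathbb{R}))$ be the solution of the dissipative Kac equation $$\partial_t \widehat f_\varepsilon(\xi,t)=2\int_0^{\pi/2} b_\varepsilon(\theta)\left(\widehat f_\varepsilon(\xi\cos^{p+1}\theta,t)\,\widehat f_\varepsilon(\xi\sin^{p+1}\theta,t)-\widehat f_\varepsilon(\xi,t)\right)d\theta$$ with initial datum $f_0$. Suppose in addition that: A) there is $\alpha>0$ such that $$\lim_{\xi\to 0^+}\frac{1-\widehat f_0(\xi)}{\xi^{\frac{2}{p+1}}}=\alpha;$$ B) $\widehat f_0$ is differentiable outside the origin and there is $\delta\in(0,1)$ such that for all $R>0$ there is $K(R)>0$ with $$\sup_{0<\xi\le R,\ 0<\tau\le R,\ \xi\ne\tau}\frac{\left|\dfrac{\partial_\xi\widehat f_0(\xi)}{\xi^{\frac{1-p}{p+1}}}-\dfrac{\partial_\xi\widehat f_0(\tau)}{\tau^{\frac{1-p}{p+1}}}\right|}{|\xi-\tau|^{\delta}}\le K(R).$$ Let $f(t)$ be the solution, given by $$\widehat f(\xi,t)=\widehat f_0\left(\xi e^{-(p+1)t}\right)e^{-\alpha|\xi|^{\frac{2}{p+1}}(1-e^{-2t})},$$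 of the Fokker--Planck equation $$\partial_t\widehat f(\xi,t)=-2\alpha|\xi|^{\frac{2}{p+1}}\widehat f(\xi,t)-(p+1)\,\xi\,\partial_\xi\widehat f(\xi,t)$$ with the same initial datum $f_0$ and with $\alpha$ as in A). Then $$\lim_{\varepsilon\to 0}\ \sup_{t\ge 0,\ \xi\ne 0}\frac{\left|\widehat f_\varepsilon(\xi,t)-\widehat f(\xi,t)\right|}{|\xi|^{\frac{2}{p+1}}}=0.$$
   Context: The Fourier transform is taken in the variable $v$: $\widehat g(\xi)=\int_{\mathbb{R}}e^{-i\xi v}g(v)\,dv$, and $\widehat f(\xi,t)$ is the Fourier transform of $f(\cdot,t)$. A family $\{b_\varepsilon\}_{\varepsilon>0}$ of functions on $[-\frac{\pi}{2},\frac{\pi}{2}]$ is a grazing collision family if (a) $b_\varepsilon(\theta)=b_\varepsilon(|\theta|)\ge 0$; (b) $\operatorname{supp} b_\varepsilon\subset\{\theta\in[-\frac{\pi}{2},\frac{\pi}{2}]:\ 0<c_\varepsilon\le|\theta|\le d_\varepsilon\}$, where $d_\varepsilon\to 0$ as $\varepsilon\to 0$; (c) $\int_0^{\pi/2}b_\varepsilon(\theta)\sin^2\theta\,d\theta=1$ for all $\varepsilon$. For integrable kernels the Kac initial value problem has a unique nonnegative solution in $C^1([0,\infty),L^1(\mathbb{R}))$, which has unit mass for all times and is even when $f_0$ is even. *)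

(* Defs.v *)
From HB Require Import structures.
From mathcomp Require Import all_boot all_order all_algebra.
From mathcomp Require Import all_classical all_reals all_analysis.
From mathcomp Require Import complex ring lra.

Set Implicit Arguments.
Unset Strict Implicit.
Unset Printing Implicit Defensive.
Import Order.TTheory GRing.Theory Num.Theory.
Import numFieldNormedType.Exports.
Local Open Scope classical_set_scope.
Local Open Scope ring_scope.
Local Open Scope complex_scope.

Section Defs.
Context {R : realType}.
Implicit Types (g : R -> R) (F : R -> R[i]) (f : R -> R -> R).

Local Notation mu := (@lebesgue_measure R).

Definition expi (x : R) : R[i] := cos x +i* sin x.

Definition cintegral (D : set R) F : R[i] :=
  (\int[mu]_(x in D) complex.Re (F x)) +i* (\int[mu]_(x in D) complex.Im (F x)).

Definition fourier g (xi : R) : R[i] :=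
  cintegral setT (fun v => expi (- (xi * v)) * (g v)%:C).

(* The derivative is relative to D, hence one-sided at an endpoint of D. *)
Definition has_derivative_in (D : set R) F (x : R) (l : R[i]) : Prop :=
  ((h^-1)%:C * (F (x + h) - F x) : R[i]^o)
    @[h --> within [set h | D (x + h)] 0^'] --> (l : R[i]^o).

Definition halfline : set R := [set t | 0 <= t].

(* [f t] and [df t] are representatives of elements of L^1(R); values at
   negative times are irrelevant. *)
Definition C1_L1 f : Prop := exists df : R -> R -> R, forall t : R, 0 <= t ->
  [/\ mu.-integrable setT (EFin \o f t),
      mu.-integrable setT (EFin \o df t),
      Lnorm mu 1%E (fun v => (h^-1 * (f (t + h) v - f t v) - df t v)%:E)
        @[h --> within [set h | halfline (t + h)] 0^'] --> 0%E
    & Lnorm mu 1%E (fun v => (df s v - df t v)%:E)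
        @[s --> within halfline (nbhs t)] --> 0%E].

Definition kac_rhs (p : R) (b : R -> R) F (xi : R) : R[i] :=
  2%:R * cintegral `[0, pi / 2]
    (fun th => (b th)%:C *
       (F (xi * cos th `^ (p + 1)) * F (xi * sin th `^ (p + 1)) - F xi)).

Definition kac_solution (p : R) (b : R -> R) (f0 : R -> R) f : Prop :=
  [/\ C1_L1 f,
      (forall t : R, 0 <= t -> {ae mu, forall v, 0 <= f t v}),
      {ae mu, forall v, f 0 v = f0 v}
    & forall t xi : R, 0 <= t ->
        has_derivative_in halfline (fun s => fourier (f s) xi) t
          (kac_rhs p b (fourier (f t)) xi)].

Definition angles : set R := `[- (pi / 2), pi / 2].

Definition grazing_family (b : R -> R -> R) : Prop :=
  [/\ (forall e th : R, 0 < e -> angles th ->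
         b e th = b e `|th| /\ 0 <= b e th),
      (exists c d : R -> R,
         [/\ forall e : R, 0 < e -> 0 < c e,
             forall e : R, 0 < e ->
               closure [set th | angles th /\ b e th != 0] `<=`
               [set th | angles th /\ c e <= `|th| <= d e]
           & d e @[e --> 0^'+] --> 0])
    & forall e : R, 0 < e ->
        (\int[mu]_(th in `[0%R, (pi / 2)%R]) (b e th * sin th ^+ 2)%:E = 1)%E].

(* The Fokker-Planck solution is given through its transform only;
   [fp_hat_fokker_planck] and [fp_hat0] below show that it solves the Cauchy
   problem. *)
Definition fp_hat (p alpha : R) (f0 : R -> R) (xi t : R) : R[i] :=
  fourier f0 (xi * expR (- ((p + 1) * t))) *
  (expR (- (alpha * `|xi| `^ (2 / (p + 1)) * (1 - expR (- (2 * t))))))%:C.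

(* The equation in Fourier variables. At xi = 0 the term xi * d/dxi vanishes although the transform need not be
   differentiable there. *)
Definition fokker_planck (p alpha : R) (fh : R -> R -> R[i]) : Prop :=
  forall t xi : R, 0 <= t ->
    if xi == 0 then has_derivative_in halfline (fh xi) t 0
    else exists2 d : R[i], has_derivative_in setT (fh ^~ t) xi d &
      has_derivative_in halfline (fh xi) t
        (- (2 * alpha * `|xi| `^ (2 / (p + 1)))%:C * fh xi t
         - ((p + 1) * xi)%:C * d).

Lemma cvg_complexP {T : Type} (G : set_system T) {FG : Filter G}
    (f : T -> R[i]) (l : R[i]) :
  (f x : R[i]^o) @[x --> G] --> (l : R[i]^o) <->
  (complex.Re (f x) @[x --> G] --> complex.Re l /\
   complex.Im (f x) @[x --> G] --> complex.Im l).
Proof.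
split=> [/cvgrPdist_lt fl | [/cvgrPdist_lt fr /cvgrPdist_lt fi]].
  split; apply/cvgrPdist_lt => e e0.
  - have /fl : 0 < e%:C :> R[i] by rewrite ltcR.
    apply: filterS => x /(le_lt_trans (normc_ge_Re _)); rewrite ltcR.
    by case: (f x) => a b; case: (l).
  - have /fl : 0 < e%:C :> R[i] by rewrite ltcR.
    apply: filterS => x; rewrite normc_def ltcR; apply: le_lt_trans.
    rewrite -sqrtr_sqr ler_wsqrtr//.
    by case: (f x) => a b; case: (l) => c d /=; rewrite lerDr sqr_ge0.
apply/cvgrPdist_lt => -[e e']; rewrite ltcE /= => /andP[/eqP -> e0].
have e20 : 0 < e / 2 by rewrite divr_gt0.
near=> x.
rewrite normc_def ltcR.
have [re im] : `|complex.Re l - complex.Re (f x)| < e / 2 /\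
    `|complex.Im l - complex.Im (f x)| < e / 2.
  by split; near: x; [exact: fr|exact: fi].
rewrite -[ltRHS]gtr0_norm// -sqrtr_sqr ltr_sqrt ?exprn_gt0//.
move: re im; case: (f x) => a b; case: (l) => c d /=.
rewrite -(real_normK (num_real (c - a))) -(real_normK (num_real (d - b))).
have := normr_ge0 (c - a); have := normr_ge0 (d - b).
move: `|c - a| `|d - b| => u v; nra.
Unshelve. all: by end_near. Qed.

Lemma has_derivative_inP F x l : has_derivative_in setT F x l <->
  (is_derive x 1 (fun y => complex.Re (F y)) (complex.Re l) /\
   is_derive x 1 (fun y => complex.Im (F y)) (complex.Im l)).
Proof.
have isd (f : R -> R) d : is_derive x 1 f d <->
    h^-1 * (f (x + h) - f x) @[h --> 0^'] --> d.
  have -> : (fun h => h^-1 * (f (x + h) - f x)) =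
     (fun h => h^-1 *: ((f \o shift x) (h *: (1 : R)) - f x)).
    by apply/funext => h; rewrite /= [h *: _]mulr1 (addrC x).
  split=> [[df <-]|fd]; first exact: df.
  by apply: DeriveDef; [apply/cvg_ex; exists d|exact: cvg_lim].
rewrite !isd.
have reE (k : R) (a b : R[i]) : complex.Re (k%:C * (a - b)) =
    k * (complex.Re a - complex.Re b).
  by case: a b => [a ?] [b ?] /=; rewrite mul0r subr0.
have imE (k : R) (a b : R[i]) : complex.Im (k%:C * (a - b)) =
    k * (complex.Im a - complex.Im b).
  by case: a b => [? a] [? b] /=; rewrite mul0r addr0.
have -> : has_derivative_in setT F x l =
   (((h^-1)%:C * (F (x + h) - F x) : R[i]^o) @[h --> 0^'] --> (l : R[i]^o)).
  rewrite /has_derivative_in.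
  have -> : [set h | [set: R] (x + h)] = setT by apply/seteqP; split.
  suff -> : within [set: R] (0 : R)^' = 0^' by [].
  by apply/seteqP; split=> A; rewrite /within/=; apply: filterS => // z /(_ I).
rewrite cvg_complexP.
under eq_fun do rewrite reE.
by under [X in _ /\ (nbhs (fmap X _) `=>` _) <-> _]eq_fun do rewrite imE.
Qed.

Lemma has_derivative_inW D F x l :
  has_derivative_in setT F x l -> has_derivative_in D F x l.
Proof.
rewrite /has_derivative_in.
have -> : [set h | [set: R] (x + h)] = setT by apply/seteqP; split.
suff -> : within [set: R] (0 : R)^' = 0^' by exact: cvg_within_filter.
by apply/seteqP; split=> A; rewrite /within/=; apply: filterS => // z /(_ I).
Qed.

Lemma is_derive_norm_powR (q x : R) : x != 0 ->
  is_derive x 1 (fun y : R => `|y| `^ q) (q * `|x| `^ q / x).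
Proof.
have pB (y : R) : 0 < y -> y `^ (q - 1) = y `^ q / y.
  move=> y0; rewrite powRD; last by rewrite (gt_eqF y0) implybT.
  by rewrite powRN powRr1 ?ltW.
rewrite neq_lt => /orP[x0|x0].
  have nx0 : 0 < - x by rewrite oppr_gt0.
  apply: (@near_eq_is_derive R R^o R^o (fun y : R => (- y) `^ q)).
    near=> y; rewrite ltr0_norm//; near: y; exact: lt_nbhsl.
  have := @is_derive1_comp R (fun y => y `^ q) (fun y => - y) x _ _
    (is_derive1_powR q nx0) (is_deriveN (is_derive_id x 1)).
  move=> h; apply: is_derive_eq h _.
  by rewrite ltr0_norm// pB//; field; rewrite ltr0_neq0.
apply: (@near_eq_is_derive R R^o R^o (fun y => @powR R y q)).
  near=> y; rewrite gtr0_norm//; near: y; exact: lt_nbhsr.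
apply: is_derive_eq (is_derive1_powR q x0) _.
by rewrite gtr0_norm// pB// mulrA.
Unshelve. all: by end_near. Qed.

Lemma is_derive_fp_xi (u : R -> R) (du al q a c x : R) : x != 0 ->
  is_derive (x * a) 1 u du ->
  is_derive x 1 (fun y => u (y * a) * expR (- (al * `|y| `^ q * c)))
   ((du * a - u (x * a) * (al * q * `|x| `^ q / x * c)) *
    expR (- (al * `|x| `^ q * c))).
Proof.
move=> x0 ud.
have nd := is_derive_norm_powR q x0.
have d1 : is_derive x 1 (fun y => u (y * a)) (du * a).
  apply: (@is_derive1_comp R u (fun y => y * a)) => //.
  by apply: is_derive_eq (is_deriveM (is_derive_id x 1) (is_derive_cst a x 1)) _;
    rewrite scaler0 add0r [_ *: _]mulr1.
have d2 : is_derive x 1 (fun y => expR (- (al * `|y| `^ q * c)))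
    (expR (- (al * `|x| `^ q * c)) * - (al * (q * `|x| `^ q / x) * c)).
  apply: (@is_derive1_comp R expR (fun y => - (al * `|y| `^ q * c))) => //.
  have h := is_deriveZ (- (al * c)) nd.
  have -> : (fun y => - (al * `|y| `^ q * c)) =
      - (al * c) \*: (fun y : R => `|y| `^ q).
    by apply/funext => y /=; rewrite [RHS]/GRing.scale/=; ring.
  by apply: is_derive_eq h _; rewrite /GRing.scale/=; ring.
by apply: is_derive_eq (is_deriveM d1 d2) _; rewrite /GRing.scale/=; ring.
Qed.

Lemma is_derive_fp_t (u : R -> R) (du al k m x t : R) :
  is_derive (x * expR (- (m * t))) 1 u du ->
  is_derive t 1 (fun s => u (x * expR (- (m * s))) *
      expR (- (al * k * (1 - expR (- (2 * s))))))
   ((- m * x * expR (- (m * t)) * du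
     - u (x * expR (- (m * t))) * (al * k * 2 * expR (- (2 * t)))) *
    expR (- (al * k * (1 - expR (- (2 * t)))))).
Proof.
move=> ud.
have de (c s : R) : is_derive s 1 (fun r => expR (- (c * r)))
    (- c * expR (- (c * s))).
  have h : is_derive s 1 (fun r => - (c * r)) (- c).
    have -> : (fun r => - (c * r)) = - c \*: (id : R -> R).
      by apply/funext => r /=; rewrite /GRing.scale/= mulNr.
    by apply: is_derive_eq (is_deriveZ (- c) (is_derive_id s 1)) _;
      rewrite [_ *: _]mulr1.
  by apply: is_derive_eq (is_derive1_comp (is_derive_expR _) h) _; rewrite mulrC.
have d1 : is_derive t 1 (fun s => u (x * expR (- (m * s))))
    (du * (x * (- m * expR (- (m * t))))).
  have h : is_derive t 1 (fun s => x * expR (- (m * s)))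
      (x * (- m * expR (- (m * t)))).
    have -> : (fun s => x * expR (- (m * s))) =
       x \*: (fun s => expR (- (m * s))) by apply/funext.
    exact: is_derive_eq (is_deriveZ x (de m t)) _.
  exact: (@is_derive1_comp R u (fun s => x * expR (- (m * s))) t _ _ ud h).
have d2 : is_derive t 1 (fun s => - (al * k * (1 - expR (- (2 * s)))))
    (al * k * (- 2 * expR (- (2 * t)))).
  have -> : (fun s => - (al * k * (1 - expR (- (2 * s))))) =
      cst (- (al * k)) + (al * k) \*: (fun s => expR (- (2 * s))).
    by apply/funext => r; rewrite /= [RHS]/GRing.add/= /GRing.scale/=; ring.
  by apply: is_derive_eq (is_deriveD (is_derive_cst _ t 1)
    (is_deriveZ (al * k) (de 2 t))) _; rewrite add0r.
have d3 := is_derive1_comp (is_derive_expR _) d2.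
by apply: is_derive_eq (is_deriveM d1 d3) _; rewrite /GRing.scale/=; ring.
Qed.

Lemma fp_hat0 (p alpha : R) (f0 : R -> R) xi :
  fp_hat p alpha f0 xi 0 = fourier f0 xi.
Proof. by rewrite /fp_hat !mulr0 oppr0 expR0 mulr1 subrr mulr0 oppr0 expR0 mulr1. Qed.

Lemma fp_hat_fokker_planck (p alpha : R) (f0 : R -> R) (df0 : R -> R[i]) :
  p + 1 != 0 ->
  (forall xi, xi != 0 -> has_derivative_in setT (fourier f0) xi (df0 xi)) ->
  fokker_planck p alpha (fp_hat p alpha f0).
Proof.
move=> p1 df t xi t0.
set q := 2 / (p + 1).
have reE (z : R[i]) (k : R) : complex.Re (z * k%:C) = complex.Re z * k.
  by case: z => a b /=; rewrite mulr0 subr0.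
have imE (z : R[i]) (k : R) : complex.Im (z * k%:C) = complex.Im z * k.
  by case: z => a b /=; rewrite mulr0 add0r.
case: eqVneq => [->|xi0].
  have q0 : q != 0 by rewrite mulf_neq0 ?invr_eq0// pnatr_eq0.
  apply: has_derivative_inW; apply/has_derivative_inP.
  have -> : fp_hat p alpha f0 0 = cst (fourier f0 0).
    by apply/funext => s; rewrite /fp_hat -/q mul0r normr0 powR0// mulr0 mul0r oppr0 expR0 mulr1.
  by split; exact: is_derive_cst.
set a := expR (- ((p + 1) * t)); set c := 1 - expR (- (2 * t)).
have xa0 : xi * a != 0 by rewrite mulf_neq0// gt_eqF// expR_gt0.
have /has_derivative_inP[dr di] := df _ xa0.
exists ((df0 (xi * a) * a%:C
   - fourier f0 (xi * a) * (alpha * q * `|xi| `^ q / xi * c)%:C)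
   * (expR (- (alpha * `|xi| `^ q * c)))%:C).
  apply/has_derivative_inP; split.
  - under eq_fun do rewrite /fp_hat reE.
    apply: is_derive_eq (is_derive_fp_xi alpha q c xi0 dr) _.
    by rewrite reE; case: (df0 _) => ? ?; case: (fourier _ _) => ? ? /=; ring.
  - under eq_fun do rewrite /fp_hat imE.
    apply: is_derive_eq (is_derive_fp_xi alpha q c xi0 di) _.
    by rewrite imE; case: (df0 _) => ? ?; case: (fourier _ _) => ? ? /=; ring.
apply: has_derivative_inW; apply/has_derivative_inP; split.
- under eq_fun do rewrite /fp_hat reE.
  apply: is_derive_eq (is_derive_fp_t alpha (`|xi| `^ q) dr) _.
  rewrite /fp_hat -/q -/a -/c; case: (df0 _) => ? ?; case: (fourier _ _) => ? ? /=.
  rewrite /c /q; field; exact/andP.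
- under eq_fun do rewrite /fp_hat imE.
  apply: is_derive_eq (is_derive_fp_t alpha (`|xi| `^ q) di) _.
  rewrite /fp_hat -/q -/a -/c; case: (df0 _) => ? ?; case: (fourier _ _) => ? ? /=.
  rewrite /c /q; field; exact/andP.
Qed.

End Defs.

(* Main.v *)
(** In Fourier variables both equations contract with respect to the weight
    [|xi| `^ q], [q = 2 / (p + 1)], because
    [(cos th `^ (p + 1)) `^ q + (sin th `^ (p + 1)) `^ q = 1].  The Fokker-Planck
    solution is [f0hat eta * E xi] with [eta = xi * expR (- (p + 1) t)], and
    [E] is multiplicative along collisions; hence its residual in the Kac equation
    is [E xi] times the residual of [f0hat] at [eta], which is
    [expR (- 2 t) * |xi| `^ q] times a quantity that does not depend on time.
    So it suffices that the residual of [f0hat], divided by [eta `^ q], vanishes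
    uniformly on [0 < eta <= r] as the collisions become grazing.  With
    [y = eta `^ q], the point [eta * cos th `^ (p + 1)] corresponds to
    [y * cos th ^+ 2], so a first-order expansion of [f0hat] in [y], whose
    derivative is Hoelder continuous by B), together with A) for the factor at
    [eta * sin th `^ (p + 1)], gives an error [o(sin th ^+ 2 * y)], and the kernel
    integrates [sin th ^+ 2] to 1.  Frequencies [|xi| > r] are harmless since both
    transforms are bounded by 1. *)

Require Import Defs.
From HB Require Import structures.
From mathcomp Require Import all_boot all_order all_algebra.
From mathcomp Require Import all_classical all_reals all_analysis.
From mathcomp Require Import measurable_realfun complex ring lra.
Import Order.TTheory GRing.Theory Num.Theory.
Import numFieldNormedType.Exports.
Local Open Scope classical_set_scope.
Local Open Scope ring_scope.
Local Open Scope complex_scope.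

(** * Modulus estimates for complex numbers *)

Section ComplexModulus.
Context {R : realType}.
Implicit Types (a b : R) (x y z : R[i]).
Local Notation normc := (@Normc.normc R).
Local Notation Re := complex.Re.
Local Notation Im := complex.Im.

Lemma normc_ge0 z : 0 <= normc z.
Proof. by case: z => a b; exact: sqrtr_ge0. Qed.

Lemma normcD_le x y : normc (x + y) <= normc x + normc y.
Proof. exact: le_normcD. Qed.

Lemma normc_opp z : normc (- z) = normc z.
Proof. exact: normcN. Qed.

Lemma normcB_le x y : normc (x - y) <= normc x + normc y.
Proof. by rewrite -(normc_opp y) normcD_le. Qed.

Lemma normc_real a : normc a%:C = `|a|.
Proof. by rewrite /= expr0n/= addr0 sqrtr_sqr. Qed.

(** Cauchy-Schwarz in the plane: by Lagrange's identity the difference of the two squares is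
    [(a * y - b * x) ^+ 2]. *)
Lemma dot_le_normc a b z : a ^+ 2 + b ^+ 2 = 1 ->
  a * Re z + b * Im z <= normc z.
Proof.
case: z => x y /= ab1.
apply: (le_trans (ler_norm _)); rewrite -sqrtr_sqr ler_wsqrtr//.
rewrite -[leRHS]mul1r -ab1 -subr_ge0.
rewrite (_ : _ - _ = (a * y - b * x) ^+ 2) ?sqr_ge0//; ring.
Qed.

(** Together with [dot_le_normc] this presents the modulus as a supremum of real projections.
    Complex differential inequalities and complex integrals are thereby reduced to real ones with
    the sharp constant 1. *)
Lemma normc_le_dot z (M : R) : 0 <= M ->
  (forall a b, a ^+ 2 + b ^+ 2 = 1 -> a * Re z + b * Im z <= M) ->
  normc z <= M.
Proof.
move=> M0 dM; have [->|z0] := eqVneq (normc z) 0 => //.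
have zz : Re z ^+ 2 + Im z ^+ 2 = normc z ^+ 2.
  by case: z {dM z0} => x y /=; rewrite sqr_sqrtr// addr_ge0 ?sqr_ge0.
(* The direction of [z] itself attains the modulus. *)
have := dM (Re z / normc z) (Im z / normc z).
rewrite !expr_div_n -mulrDl zz divff ?expf_neq0// => /(_ erefl).
by rewrite mulrAC [Im z / _ * _]mulrAC -mulrDl -!expr2 zz expr2 mulfK.
Qed.

Lemma abs_Re_le_normc z : `|Re z| <= normc z.
Proof.
case: z => x y /=; rewrite -sqrtr_sqr ler_wsqrtr//.
by rewrite lerDl sqr_ge0.
Qed.

Lemma abs_Im_le_normc z : `|Im z| <= normc z.
Proof.
case: z => x y /=; rewrite -sqrtr_sqr ler_wsqrtr//.
by rewrite lerDr sqr_ge0.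
Qed.

Lemma normc_le_abs z : normc z <= `|Re z| + `|Im z|.
Proof.
case: z => x y /=; rewrite -[leRHS]ger0_norm ?addr_ge0//.
rewrite -sqrtr_sqr ler_wsqrtr// sqrrD !real_normK ?num_real//.
by rewrite -addrA lerD2l lerDr mulrn_wge0// mulr_ge0.
Qed.

(** One factor is exchanged at a time, and each remaining factor has modulus at most 1. *)
Lemma normcM_sub_le (x1 x2 y1 y2 : R[i]) : normc x2 <= 1 -> normc y1 <= 1 ->
  normc (x1 * x2 - y1 * y2) <= normc (x1 - y1) + normc (x2 - y2).
Proof.
move=> x21 y11.
have -> : x1 * x2 - y1 * y2 = (x1 - y1) * x2 + y1 * (x2 - y2) by ring.
apply: (le_trans (normcD_le _ _)); rewrite !Normc.normcM lerD//.
  by rewrite ler_piMr ?normc_ge0.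
by rewrite ler_piMl ?normc_ge0.
Qed.

End ComplexModulus.

(** * Differential inequalities on the closed half-line *)

Section Comparison.
Context {R : realType}.
Local Notation normc := (@Normc.normc R).
Local Notation Re := complex.Re.
Local Notation Im := complex.Im.

Lemma halfline_derivative_dot (u : R -> R[i]) (t : R) (l : R[i]) (a b : R) :
  has_derivative_in halfline u t l ->
  h^-1 * ((a * Re (u (t + h)) + b * Im (u (t + h))) -
          (a * Re (u t) + b * Im (u t)))
    @[h --> within [set h | halfline (t + h)] 0^'] --> a * Re l + b * Im l.
Proof.
move=> /cvg_complexP [re im].
have -> : (fun h : R => h^-1 * ((a * Re (u (t + h)) + b * Im (u (t + h))) -
          (a * Re (u t) + b * Im (u t)))) =
   (fun h : R => a * Re ((h^-1)%:C * (u (t + h) - u t)) +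
               b * Im ((h^-1)%:C * (u (t + h) - u t))).
  apply/funext => h; case: (u (t + h)) => x y; case: (u t) => x' y' /=.
  ring.
by apply: cvgD; apply: cvgMr.
Qed.

(** At a positive time the half-line is a neighbourhood of [t], so the relative derivative is an
    ordinary two-sided one. *)
Lemma halfline_is_derive (w : R -> R) (t l : R) : 0 < t ->
  h^-1 * (w (t + h) - w t) @[h --> within [set h | halfline (t + h)] 0^'] --> l ->
  is_derive t 1 w l.
Proof.
move=> t0 wl.
have wl' : h^-1 *: ((w \o shift t) (h *: (1 : R)) - w t) @[h --> 0^'] --> l.
  have -> : (fun h => h^-1 *: ((w \o shift t) (h *: (1 : R)) - w t)) =
    (fun h => h^-1 * (w (t + h) - w t)).
    by apply/funext => h /=; rewrite [h *: _]mulr1 (addrC t).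
  apply: cvg_trans wl; apply: cvg_app.
  move=> A /= wA.
  have nt : \forall h \near (0 : R)^', halfline (t + h).
    apply: nbhs_dnbhs; near=> h; rewrite /halfline/=.
    have : - t < h by near: h; apply: lt_nbhsr; rewrite oppr_lt0.
    by move=> ?; rewrite -lerBlDl sub0r ltW.
  have {}wA : \forall h \near (0 : R)^', halfline (t + h) -> A h := wA.
  by near=> h; apply: (near wA h) => //; exact: (near nt h).
by apply: DeriveDef; [apply/cvg_ex; exists l|exact: cvg_lim].
Unshelve. all: by end_near. Qed.

(** Differentiability gives continuity. Only the endpoint 0, where the derivative is one-sided,
    needs an argument of its own. *)
Lemma halfline_within_continuous (w dw : R -> R) (T : R) : 0 < T ->
  (forall t, 0 <= t ->
    h^-1 * (w (t + h) - w t) @[h --> within [set h | halfline (t + h)] 0^']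
      --> dw t) ->
  {within `[0, T], continuous w}.
Proof.
move=> T0 wd.
have wc t : 0 < t -> {for t, continuous w}.
  move=> t0; apply/differentiable_continuous/derivable1_diffP.
  by have [] := halfline_is_derive _ _ _ t0 (wd _ (ltW t0)).
apply/continuous_within_itvP => //; split.
- by move=> x; rewrite in_itv/= => /andP[x0 _]; exact: wc.
- have w0 := wd _ (lexx 0).
  have h0 : h^-1 * (w h - w 0) @[h --> 0^'+] --> dw 0.
    move: w0; under eq_fun do rewrite add0r.
    apply: cvg_trans; apply: cvg_app => A wA.
    have {}wA : \forall h \near (0 : R), h != 0 -> halfline (0 + h) -> A h := wA.
    suff : \forall h \near (0 : R), 0 < h -> A h by [].
    by near=> h => hp; apply: (near wA h) => //; rewrite ?gt_eqF// /halfline/= add0r ltW.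
  (* For [h != 0] the expression on the left is just [w h], so its limit is the right continuity of
     [w] at 0. *)
  have : w 0 + h * (h^-1 * (w h - w 0)) @[h --> 0^'+] --> w 0 + 0 * dw 0.
    apply: cvgD; first exact: cvg_cst.
    by apply: cvgM h0; apply: cvg_at_right_filter; exact: cvg_id.
  rewrite mul0r addr0; apply: cvg_trans; apply: near_eq_cvg.
  by near=> h; rewrite mulVKf ?gt_eqF// addrC subrK.
- by apply: cvg_at_left_filter; exact: wc.
Unshelve. all: by end_near. Qed.

(* The derivative of [s |-> expR (lam * s) * (w s - h s)] is nonpositive. *)
Lemma linear_comparison (w dw h dh : R -> R) (lam T : R) : 0 < T ->
  (forall s : R, 0 < s < T -> is_derive s 1 w (dw s)) ->
  (forall s : R, is_derive s 1 h (dh s)) ->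
  {within `[0, T], continuous w} ->
  w 0 <= h 0 ->
  (forall s, 0 < s < T -> dw s + lam * w s <= dh s + lam * h s) ->
  w T <= h T.
Proof.
move=> T0 wd hd wc wh0 le_d.
pose g (s : R) := expR (lam * s) * (w s - h s).
have ed (s : R) : is_derive s 1 (fun s => expR (lam * s)) (lam * expR (lam * s)).
  have d1 : is_derive s 1 (fun r : R => lam * r) lam.
    by apply: is_derive_eq (is_deriveZ lam (is_derive_id s 1)) _; rewrite [_ *: _]mulr1.
  by apply: is_derive_eq (is_derive1_comp (is_derive_expR _) d1) _; rewrite mulrC.
have gd (s : R) : 0 < s < T -> is_derive s 1 g
    (expR (lam * s) * ((dw s + lam * w s) - (dh s + lam * h s))).
  move=> s0; have wds := wd _ s0; have hds := hd s; have eds := ed s.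
  apply: is_derive_eq (is_deriveM eds (is_deriveB wds hds)) _.
  rewrite !fctE /GRing.scale/=; ring.
have cE : {within `[0, T], continuous (fun s => expR (lam * s))}.
  apply: derivable_within_continuous => s _; by have [] := ed s.
have cH : {within `[0, T], continuous h}.
  apply: derivable_within_continuous => s _; by have [] := hd s.
have cg : {within `[0, T], continuous g}.
  by move=> s; apply: cvgM; [exact: cE|apply: cvgB; [exact: wc|exact: cH]].
have itvE s : s \in `]0, T[ -> 0 < s < T by rewrite in_itv.
have : g T <= g 0.
  apply: (@ler0_derive1_le_cc R g 0 T) => //; rewrite ?in_itv/= ?lexx ?ltW//.
  - by move=> s /itvE s0; have [] := gd _ s0.
  - move=> s /itvE s0; rewrite derive1E.
    have [_ ->] := gd _ s0.
    by rewrite mulr_ge0_le0 ?expR_ge0// subr_le0; exact: le_d.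
rewrite /g mulr0 expR0 mul1r => gT0.
rewrite -subr_le0 -(pmulr_rle0 _ (expR_gt0 (lam * T))).
by apply: (le_trans gT0); rewrite subr_le0.
Qed.

(** Every real projection [a * Re u + b * Im u] along a unit vector satisfies the scalar inequality
    of [linear_comparison], and [normc_le_dot] reassembles the modulus. Differentiating the modulus
    itself, which may fail at zeros of [u], is avoided. *)
Lemma normc_comparison (u du : R -> R[i]) (h dh : R -> R) (lam : R) :
  (forall t, 0 <= t -> has_derivative_in halfline u t (du t)) ->
  (forall t : R, is_derive t 1 h (dh t)) ->
  (forall t, 0 <= t -> 0 <= h t) ->
  u 0 = 0 ->
  (forall t, 0 <= t ->
    normc (du t + lam%:C * u t) <= dh t + lam * h t) ->
  forall t, 0 <= t -> normc (u t) <= h t.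
Proof.
move=> ud hd h0 u0 le_d t; rewrite le_eqVlt => /predU1P[<-|t0].
  by rewrite u0 Normc.normc0 h0.
apply: normc_le_dot => [|a b ab1]; first by rewrite h0 ?ltW.
pose w s := a * Re (u s) + b * Im (u s).
pose dw s := a * Re (du s) + b * Im (du s).
have wd s : 0 <= s ->
    r^-1 * (w (s + r) - w s) @[r --> within [set r | halfline (s + r)] 0^']
      --> dw s.
  by move=> s0; exact: halfline_derivative_dot (ud _ s0).
apply: (@linear_comparison w dw h dh lam) => //.
- by move=> s /andP[s0 _]; apply: halfline_is_derive => //; exact: wd (ltW s0).
- exact: halfline_within_continuous wd.
- by rewrite /w u0 !mulr0 addr0 h0.
- move=> s /andP[s0 _]; apply: le_trans (le_d _ (ltW s0)).
  apply: le_trans (dot_le_normc _ _ _ ab1).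
  rewrite /dw /w; case: (du s) => x y; case: (u s) => x' y' /=.
  by rewrite le_eqVlt; apply/orP; left; apply/eqP; ring.
Qed.

End Comparison.

(** * Componentwise integration of complex-valued functions *)

Section ComplexIntegral.
Context {R : realType}.
Local Notation mu := (@lebesgue_measure R).
Local Notation normc := (@Normc.normc R).
Local Notation Re := complex.Re.
Local Notation Im := complex.Im.

Lemma integrable_mul_bounded (D : set R) (k g : R -> R) (M : R) :
  measurable D -> measurable_fun D k -> (forall x, D x -> `|k x| <= M) ->
  mu.-integrable D (EFin \o g) ->
  mu.-integrable D (EFin \o (fun x => k x * g x)).
Proof.
move=> mD mk kM ig.
have mg : measurable_fun D g by apply/measurable_EFinP; exact: (measurable_int mu).
apply: (@le_integrable _ _ R mu D mD _ _ _ _ (@integrableZl _ _ R mu D mD M _ ig)).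
- by apply/measurable_EFinP; exact: measurable_funM.
- move=> x Dx; rewrite /= lee_fin !normrM ler_wpM2r//.
  by apply: (le_trans (kM _ Dx)); exact: ler_norm.
Qed.

Definition cintegrable (D : set R) (F : R -> R[i]) :=
  mu.-integrable D (EFin \o (fun x => Re (F x))) /\
  mu.-integrable D (EFin \o (fun x => Im (F x))).

Lemma integrableD_EFin (D : set R) (f g : R -> R) : measurable D ->
  mu.-integrable D (EFin \o f) -> mu.-integrable D (EFin \o g) ->
  mu.-integrable D (EFin \o (fun x => f x + g x)).
Proof. by move=> mD fi gi; exact: (@integrableD _ _ R mu D mD _ _ fi gi). Qed.

Lemma integrableZl_EFin (D : set R) (k : R) (f : R -> R) : measurable D ->
  mu.-integrable D (EFin \o f) ->
  mu.-integrable D (EFin \o (fun x => k * f x)).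
Proof. by move=> mD fi; exact: (@integrableZl _ _ R mu D mD k _ fi). Qed.

Lemma integrableB_EFin (D : set R) (f g : R -> R) : measurable D ->
  mu.-integrable D (EFin \o f) -> mu.-integrable D (EFin \o g) ->
  mu.-integrable D (EFin \o (fun x => f x - g x)).
Proof. by move=> mD fi gi; exact: (@integrableB _ _ R mu D mD _ _ fi gi). Qed.

(** A projection of the integral is the integral of the projection, which [H] dominates pointwise.
    Bounding real and imaginary parts separately would lose a constant. *)
Lemma normc_cintegral_le (D : set R) (F : R -> R[i]) (H : R -> R) :
  measurable D -> cintegrable D F -> mu.-integrable D (EFin \o H) ->
  (forall x, D x -> normc (F x) <= H x) ->
  normc (cintegral D F) <= \int[mu]_(x in D) H x.
Proof.
move=> mD [rF iF] iH FH; apply: normc_le_dot => [|a b ab1].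
  by apply: Rintegral_ge0 => x Dx; apply: le_trans (FH _ Dx); exact: normc_ge0.
rewrite /cintegral/= -!RintegralZl// -RintegralD//; try exact: integrableZl_EFin.
apply: le_Rintegral => //.
  by apply: integrableD_EFin => //; exact: integrableZl_EFin.
by move=> x Dx; apply: le_trans (FH _ Dx); exact: dot_le_normc.
Qed.

Lemma cintegralB (D : set R) (F G : R -> R[i]) : measurable D ->
  cintegrable D F -> cintegrable D G ->
  cintegral D (fun x => F x - G x) = cintegral D F - cintegral D G.
Proof.
move=> mD [rF iF] [rG iG].
transitivity ((\int[mu]_(x in D) Re (F x) - \int[mu]_(x in D) Re (G x)) +i*
  (\int[mu]_(x in D) Im (F x) - \int[mu]_(x in D) Im (G x))); last by [].
rewrite -!RintegralB//; congr (_ +i* _); apply: eq_Rintegral => x _;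
  by case: (F x) => ? ?; case: (G x).
Qed.

Lemma cintegrableB (D : set R) (F G : R -> R[i]) : measurable D ->
  cintegrable D F -> cintegrable D G -> cintegrable D (fun x => F x - G x).
Proof.
move=> mD [rF iF] [rG iG]; split.
- have -> : (fun x => Re (F x - G x)) = (fun x => Re (F x) - Re (G x)).
    by apply/funext => x; case: (F x) => ? ?; case: (G x).
  exact: integrableB_EFin.
- have -> : (fun x => Im (F x - G x)) = (fun x => Im (F x) - Im (G x)).
    by apply/funext => x; case: (F x) => ? ?; case: (G x).
  exact: integrableB_EFin.
Qed.

Lemma cintegralM_real (D : set R) (F : R -> R[i]) (k : R) : measurable D ->
  cintegrable D F ->
  cintegral D (fun x => k%:C * F x) = k%:C * cintegral D F.
Proof.
move=> mD [rF iF].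
transitivity ((k * \int[mu]_(x in D) Re (F x)) +i*
  (k * \int[mu]_(x in D) Im (F x))); last first.
  by apply/eqP; rewrite eq_complex /= !mul0r subr0 addr0 !eqxx.
rewrite -!RintegralZl//.
by congr (_ +i* _); apply: eq_Rintegral => x _;
  case: (F x) => ? ? /=; rewrite !mul0r ?subr0 ?addr0.
Qed.

Lemma eq_cintegral (D : set R) (F G : R -> R[i]) :
  (forall x, D x -> F x = G x) -> cintegral D F = cintegral D G.
Proof.
by move=> FG; rewrite /cintegral; congr (_ +i* _);
  apply: eq_Rintegral => x /set_mem Dx; rewrite FG.
Qed.

Lemma cintegral_scaled_cst (D : set R) (g : R -> R) (z : R[i]) : measurable D ->
  mu.-integrable D (EFin \o g) ->
  cintegral D (fun x => (g x)%:C * z) = (\int[mu]_(x in D) g x)%:C * z.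
Proof.
move=> mD ig; case: z => a b.
transitivity ((\int[mu]_(x in D) g x * a) +i* (\int[mu]_(x in D) g x * b));
  last by apply/eqP; rewrite eq_complex /= !mul0r subr0 addr0 !eqxx.
rewrite -!RintegralZr//.
by congr (_ +i* _); apply: eq_Rintegral => x _ /=; rewrite !mul0r ?subr0 ?addr0.
Qed.

Lemma cintegrable_scaled (D : set R) (g : R -> R) (F : R -> R[i]) (M : R) :
  measurable D -> mu.-integrable D (EFin \o g) ->
  measurable_fun D (fun x => Re (F x)) -> measurable_fun D (fun x => Im (F x)) ->
  (forall x, D x -> normc (F x) <= M) ->
  cintegrable D (fun x => (g x)%:C * F x).
Proof.
move=> mD ig mr mi FM; split.
- have -> : (fun x => Re ((g x)%:C * F x)) = (fun x => Re (F x) * g x).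
    by apply/funext => x; case: (F x) => ? ? /=; rewrite mul0r subr0 mulrC.
  apply: (@integrable_mul_bounded _ _ _ M) => // x Dx.
  by apply: le_trans (FM _ Dx); exact: abs_Re_le_normc.
- have -> : (fun x => Im ((g x)%:C * F x)) = (fun x => Im (F x) * g x).
    by apply/funext => x; case: (F x) => ? ? /=; rewrite mul0r addr0 mulrC.
  apply: (@integrable_mul_bounded _ _ _ M) => // x Dx.
  by apply: le_trans (FM _ Dx); exact: abs_Im_le_normc.
Qed.

End ComplexIntegral.

(** * Fourier transforms of integrable functions on the line *)

Section Fourier.
Context {R : realType}.
Local Notation mu := (@lebesgue_measure R).
Local Notation normc := (@Normc.normc R).
Local Notation Re := complex.Re.
Local Notation Im := complex.Im.
Implicit Types (g : R -> R) (xi : R).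

Lemma continuous_phase_cos xi : continuous (fun v : R => cos (- (xi * v))).
Proof.
move=> v; apply: continuous_comp; last exact: continuous_cos.
by apply: cvgN; apply: cvgMr; exact: cvg_id.
Qed.

Lemma continuous_phase_sin xi : continuous (fun v : R => sin (- (xi * v))).
Proof.
move=> v; apply: continuous_comp; last exact: continuous_sin.
by apply: cvgN; apply: cvgMr; exact: cvg_id.
Qed.

Lemma abs_cos_le1 (x : R) : `|cos x| <= 1.
Proof. by rewrite ler_norml cos_geN1 cos_le1. Qed.

Lemma abs_sin_le1 (x : R) : `|sin x| <= 1.
Proof. by rewrite ler_norml sin_geN1 sin_le1. Qed.

Lemma fourierE g xi : fourier g xi =
  (\int[mu]_v (cos (- (xi * v)) * g v)) +i*
  (\int[mu]_v (sin (- (xi * v)) * g v)).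
Proof.
rewrite /fourier/cintegral; congr (_ +i* _); apply: eq_Rintegral => v _ /=.
  by rewrite mulr0 subr0.
by rewrite mulr0 add0r.
Qed.

Lemma integrable_phase_cos g xi : mu.-integrable setT (EFin \o g) ->
  mu.-integrable setT (EFin \o (fun v => cos (- (xi * v)) * g v)).
Proof.
move=> ig; apply: (@integrable_mul_bounded _ _ _ _ 1) => //.
  by apply: continuous_measurable_fun; exact: continuous_phase_cos.
by move=> x _; exact: abs_cos_le1.
Qed.

Lemma integrable_phase_sin g xi : mu.-integrable setT (EFin \o g) ->
  mu.-integrable setT (EFin \o (fun v => sin (- (xi * v)) * g v)).
Proof.
move=> ig; apply: (@integrable_mul_bounded _ _ _ _ 1) => //.
  by apply: continuous_measurable_fun; exact: continuous_phase_sin.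
by move=> x _; exact: abs_sin_le1.
Qed.

(** Continuity under the integral sign on a unit neighbourhood of [xi], with dominating function
    [|g|]; the imaginary part is treated alike. *)
Lemma continuous_Re_fourier g : mu.-integrable setT (EFin \o g) ->
  continuous (fun xi => Re (fourier g xi)).
Proof.
move=> ig xi; have -> : (fun x => Re (fourier g x)) =
    (fun x => \int[mu]_v (cos (- (x * v)) * g v)).
  by apply/funext => x; rewrite fourierE.
apply: (@continuity_under_integral R _ _ mu (fun x v => cos (- (x * v)) * g v)
  setT measurableT (xi - 1) (xi + 1) _ _ (fun v => `|g v|)).
- by move=> x _; exact: integrable_phase_cos.
- apply: aeW => v _ x _; apply: cvgMl.
  apply: (@continuous_comp R R R (fun x => - (x * v)) cos); last exact: continuous_cos.
  by apply: cvgN; apply: cvgMl; exact: cvg_id.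
- exact: integrable_abse ig.
- move=> x _; apply: aeW => v _; rewrite normrM ler_piMl//; exact: abs_cos_le1.
- by rewrite inE/= in_itv/=; apply/andP; split; lra.
Qed.

Lemma continuous_Im_fourier g : mu.-integrable setT (EFin \o g) ->
  continuous (fun xi => Im (fourier g xi)).
Proof.
move=> ig xi; have -> : (fun x => Im (fourier g x)) =
    (fun x => \int[mu]_v (sin (- (x * v)) * g v)).
  by apply/funext => x; rewrite fourierE.
apply: (@continuity_under_integral R _ _ mu (fun x v => sin (- (x * v)) * g v)
  setT measurableT (xi - 1) (xi + 1) _ _ (fun v => `|g v|)).
- by move=> x _; exact: integrable_phase_sin.
- apply: aeW => v _ x _; apply: cvgMl.
  apply: (@continuous_comp R R R (fun x => - (x * v)) sin); last exact: continuous_sin.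
  by apply: cvgN; apply: cvgMl; exact: cvg_id.
- exact: integrable_abse ig.
- move=> x _; apply: aeW => v _; rewrite normrM ler_piMl//; exact: abs_sin_le1.
- by rewrite inE/= in_itv/=; apply/andP; split; lra.
Qed.

Lemma fourier_at0 g : fourier g 0 = (\int[mu]_v g v)%:C.
Proof.
rewrite fourierE; congr (_ +i* _).
  by apply: eq_Rintegral => v _; rewrite mul0r oppr0 cos0 mul1r.
(* Zero is recast as the integral of the constant 0; whatever [fine] returns at the infinite measure
   of the line is multiplied by 0. *)
rewrite -[RHS](mul0r (fine (mu setT))) -Rintegral_cst//.
by apply: eq_Rintegral => v _; rewrite mul0r oppr0 sin0 mul0r.
Qed.

Lemma fourierN g xi : mu.-integrable setT (EFin \o g) ->
  fourier g (- xi) = conjc (fourier g xi).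
Proof.
move=> ig; rewrite !fourierE /=; congr (_ +i* _).
  by apply: eq_Rintegral => v _; rewrite mulNr !cosN.
rewrite -[in RHS]mulN1r -RintegralZl//; last exact: integrable_phase_sin.
by apply: eq_Rintegral => v _; rewrite mulNr !sinN; ring.
Qed.

Lemma aeS (P Q : R -> Prop) : (forall v, P v -> Q v) ->
  {ae mu, forall v, P v} -> {ae mu, forall v, Q v}.
Proof. by move=> PQ; apply: (@filterS _ _ (ae_filter_ringOfSetsType mu)). Qed.

Lemma Rintegral_ae_eq (f g : R -> R) :
  mu.-integrable setT (EFin \o f) -> mu.-integrable setT (EFin \o g) ->
  {ae mu, forall v, f v = g v} -> \int[mu]_v f v = \int[mu]_v g v.
Proof.
move=> fi gi fg; rewrite /Rintegral; congr fine.
apply: ae_eq_integral => //; [exact: (measurable_int mu)|exact: (measurable_int mu)|].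
by apply: aeS fg => v -> _.
Qed.

Lemma fourier_ae_eq (f g : R -> R) xi :
  mu.-integrable setT (EFin \o f) -> mu.-integrable setT (EFin \o g) ->
  {ae mu, forall v, f v = g v} -> fourier f xi = fourier g xi.
Proof.
move=> fi gi fg; rewrite !fourierE; congr (_ +i* _); apply: Rintegral_ae_eq.
all: try exact: integrable_phase_cos.
all: try exact: integrable_phase_sin.
all: by apply: aeS fg => v ->.
Qed.

Lemma normc_fourier_le g xi : mu.-integrable setT (EFin \o g) ->
  {ae mu, forall v, 0 <= g v} -> normc (fourier g xi) <= \int[mu]_v g v.
Proof.
move=> ig g0.
have ia : mu.-integrable setT (EFin \o (fun v => `|g v|)) := integrable_abse ig.
(* The bound on the integrand must hold at every point, while [g] is nonnegative only almost
   everywhere; hence the passage to [|g|]. *)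
rewrite -(Rintegral_ae_eq _ _ ia ig); last by apply: aeS g0 => v; exact: ger0_norm.
apply: normc_cintegral_le => //.
  split.
  - have -> : (fun v => Re (expi (- (xi * v)) * (g v)%:C)) =
       (fun v => cos (- (xi * v)) * g v).
      by apply/funext => v /=; rewrite mulr0 subr0.
    exact: integrable_phase_cos.
  - have -> : (fun v => Im (expi (- (xi * v)) * (g v)%:C)) =
       (fun v => sin (- (xi * v)) * g v).
      by apply/funext => v /=; rewrite mulr0 add0r.
    exact: integrable_phase_sin.
move=> v _; rewrite Normc.normcM normc_real /= cos2Dsin2 sqrtr1 mul1r//.
Qed.

End Fourier.

(** * The Kac collision operator: gain, loss and homogeneity *)

Section KacOperator.
Context {R : realType}.
Local Notation mu := (@lebesgue_measure R).
Local Notation normc := (@Normc.normc R).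
Local Notation Re := complex.Re.
Local Notation Im := complex.Im.
Local Notation I := (`[0%R, (pi / 2)%R]%classic : set R).
Implicit Types (p : R) (b : R -> R) (F G : R -> R[i]).

(** This collects what the collision estimates need of a transform: measurability, so that angular
    integrals make sense, and the bound 1, so that products can be compared factor by factor. *)
Definition unit_bounded F :=
  [/\ measurable_fun setT (fun x => Re (F x)),
      measurable_fun setT (fun x => Im (F x)) & forall x, normc (F x) <= 1].

Definition gain p F (xi th : R) : R[i] :=
  F (xi * cos th `^ (p + 1)) * F (xi * sin th `^ (p + 1)).

Lemma has_derivative_inB (D : set R) F G (x : R) (l m : R[i]) :
  has_derivative_in D F x l -> has_derivative_in D G x m ->
  has_derivative_in D (fun y => F y - G y) x (l - m).
Proof.
move=> /cvg_complexP[Fr Fi] /cvg_complexP[Gr Gi]; apply/cvg_complexP; split.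
- have -> : (fun h : R => Re ((h^-1)%:C * (F (x + h) - G (x + h) - (F x - G x)))) =
      (fun h : R => Re ((h^-1)%:C * (F (x + h) - F x)) -
                    Re ((h^-1)%:C * (G (x + h) - G x))).
    apply/funext => h; case: (F (x + h)) => ? ?; case: (G (x + h)) => ? ?.
    by case: (F x) => ? ?; case: (G x) => ? ? /=; ring.
  rewrite (_ : Re (l - m) = Re l - Re m); last by case: (l); case: (m).
  exact: (cvgB Fr Gr).
- have -> : (fun h : R => Im ((h^-1)%:C * (F (x + h) - G (x + h) - (F x - G x)))) =
      (fun h : R => Im ((h^-1)%:C * (F (x + h) - F x)) -
                    Im ((h^-1)%:C * (G (x + h) - G x))).
    apply/funext => h; case: (F (x + h)) => ? ?; case: (G (x + h)) => ? ?.
    by case: (F x) => ? ?; case: (G x) => ? ? /=; ring.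
  rewrite (_ : Im (l - m) = Im l - Im m); last by case: (l); case: (m).
  exact: (cvgB Fi Gi).
Qed.

Lemma cos_quadrant (th : R) : I th -> 0 <= cos th <= 1.
Proof.
rewrite /= in_itv/= => /andP[th0 th1]; rewrite cos_le1 andbT.
apply: cos_ge0_pihalf; rewrite th1 andbT.
by apply: le_trans th0; rewrite oppr_le0 divr_ge0 ?pi_ge0.
Qed.

Lemma sin_quadrant (th : R) : I th -> 0 <= sin th <= 1.
Proof.
rewrite /= in_itv/= => /andP[th0 th1]; rewrite sin_le1 andbT.
apply: sin_ge0_pi; rewrite th0/=.
by apply: (le_trans th1); have := @pi_ge0 R; lra.
Qed.

Lemma powR_unit_itv (x y : R) : 0 <= y -> 0 <= x <= 1 -> 0 <= x `^ y <= 1.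
Proof.
move=> y0 /andP[x0 x1]; rewrite powR_ge0/=.
have -> : (1 : R) = 1 `^ y by rewrite powR1.
by apply: ge0_ler_powR => //; rewrite ?nnegrE.
Qed.

Lemma powR_collision p (x : R) : 0 < p -> 0 <= x ->
  (x `^ (p + 1)) `^ (2 / (p + 1)) = x ^+ 2.
Proof.
move=> p0 x0; rewrite -powRrM mulrC divfK ?powR_mulrn//.
by rewrite gt_eqF// addr_gt0.
Qed.

(** The exponent [2 / (p + 1)] turns the powers [p + 1] into squares, so the identity is Pythagoras.
    It is the reason for the weight in the metric. *)
Lemma powR_cos_sin p (xi th : R) : 0 < p -> 0 <= xi -> I th ->
  (xi * cos th `^ (p + 1)) `^ (2 / (p + 1)) +
  (xi * sin th `^ (p + 1)) `^ (2 / (p + 1)) = xi `^ (2 / (p + 1)).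
Proof.
move=> p0 xi0 Ith; have /andP[c0 _] := cos_quadrant _ Ith.
have /andP[s0 _] := sin_quadrant _ Ith.
by rewrite !powRM ?powR_ge0// !powR_collision// -mulrDr cos2Dsin2 mulr1.
Qed.

Lemma measurable_cos_powR (xi y : R) :
  measurable_fun setT (fun th : R => xi * cos th `^ y).
Proof.
apply: measurable_funM => //.
apply: (measurableT_comp (measurable_powR y)).
by apply: continuous_measurable_fun; exact: continuous_cos.
Qed.

Lemma measurable_sin_powR (xi y : R) :
  measurable_fun setT (fun th : R => xi * sin th `^ y).
Proof.
apply: measurable_funM => //.
apply: (measurableT_comp (measurable_powR y)).
by apply: continuous_measurable_fun; exact: continuous_sin.
Qed.

Lemma unit_bounded_gain p F xi : unit_bounded F -> unit_bounded (gain p F xi).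
Proof.
move=> [mr mi F1]; rewrite /gain; split.
- have -> : (fun th => Re (F (xi * cos th `^ (p + 1)) * F (xi * sin th `^ (p + 1)))) =
    (fun th => Re (F (xi * cos th `^ (p + 1))) * Re (F (xi * sin th `^ (p + 1)))
     - Im (F (xi * cos th `^ (p + 1))) * Im (F (xi * sin th `^ (p + 1)))).
    by apply/funext => th; case: (F _) => ? ?; case: (F _).
  apply: measurable_funB; apply: measurable_funM.
  + exact: (measurableT_comp mr (measurable_cos_powR xi (p + 1))).
  + exact: (measurableT_comp mr (measurable_sin_powR xi (p + 1))).
  + exact: (measurableT_comp mi (measurable_cos_powR xi (p + 1))).
  + exact: (measurableT_comp mi (measurable_sin_powR xi (p + 1))).
- have -> : (fun th => Im (F (xi * cos th `^ (p + 1)) * F (xi * sin th `^ (p + 1)))) =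
    (fun th => Re (F (xi * cos th `^ (p + 1))) * Im (F (xi * sin th `^ (p + 1)))
     + Im (F (xi * cos th `^ (p + 1))) * Re (F (xi * sin th `^ (p + 1)))).
    by apply/funext => th; case: (F _) => ? ?; case: (F _).
  apply: measurable_funD; apply: measurable_funM.
  + exact: (measurableT_comp mr (measurable_cos_powR xi (p + 1))).
  + exact: (measurableT_comp mi (measurable_sin_powR xi (p + 1))).
  + exact: (measurableT_comp mi (measurable_cos_powR xi (p + 1))).
  + exact: (measurableT_comp mr (measurable_sin_powR xi (p + 1))).
- move=> th; rewrite Normc.normcM.
  by apply: mulr_ile1; rewrite ?normc_ge0 ?F1.
Qed.

Lemma cintegrable_gain p b F xi : mu.-integrable I (EFin \o b) ->
  unit_bounded F -> cintegrable I (fun th => (b th)%:C * gain p F xi th).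
Proof.
move=> ib /(unit_bounded_gain p F xi) [mr mi F1].
apply: (@cintegrable_scaled _ _ _ _ 1) => //.
- exact: measurable_funS mr.
- exact: measurable_funS mi.
Qed.

Lemma cintegrable_cst b (z : R[i]) : mu.-integrable I (EFin \o b) ->
  cintegrable I (fun th => (b th)%:C * z).
Proof. by move=> ib; apply: (@cintegrable_scaled _ _ _ _ (normc z)). Qed.

(** Integrability of the kernel lets gain and loss be integrated separately; the loss is then a
    linear damping with a constant rate. *)
Lemma kac_rhs_gain p b F xi : mu.-integrable I (EFin \o b) -> unit_bounded F ->
  kac_rhs p b F xi =
  2%:R * cintegral I (fun th => (b th)%:C * gain p F xi th)
  - (2 * \int[mu]_(th in I) b th)%:C * F xi.
Proof.
move=> ib uF; rewrite /kac_rhs.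
have -> : (2 * \int[mu]_(th in I) b th)%:C * F xi =
    2%:R * ((\int[mu]_(th in I) b th)%:C * F xi).
  by rewrite rmorphM rmorph_nat mulrA.
rewrite -mulrBr -cintegral_scaled_cst// -cintegralB//.
- congr (_ * _); apply: eq_cintegral => th _; by rewrite -mulrBr.
- exact: cintegrable_gain.
- exact: cintegrable_cst.
Qed.

(** The two factors of the gain contribute one error each. By [powR_cos_sin] their weighted parts
    add up to the weight at [xi], whereas the constant part [a] is doubled. *)
Lemma normc_gain_integral_le p b F G (xi k a r : R) : 0 < p ->
  mu.-integrable I (EFin \o b) -> (forall th, I th -> 0 <= b th) ->
  unit_bounded F -> unit_bounded G -> 0 <= xi <= r ->
  (forall x, 0 <= x <= r -> normc (F x - G x) <= k * x `^ (2 / (p + 1)) + a) ->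
  normc (cintegral I (fun th => (b th)%:C * gain p F xi th)
         - cintegral I (fun th => (b th)%:C * gain p G xi th)) <=
  (\int[mu]_(th in I) b th) * (k * xi `^ (2 / (p + 1)) + 2 * a).
Proof.
move=> p0 ib b0 uF uG /andP[xi0 xir] FG.
rewrite -cintegralB//; try exact: cintegrable_gain.
rewrite -RintegralZr//; apply: normc_cintegral_le => //.
- by apply: cintegrableB => //; exact: cintegrable_gain.
- have -> : (fun th => b th * (k * xi `^ (2 / (p + 1)) + 2 * a)) =
    (fun th => (k * xi `^ (2 / (p + 1)) + 2 * a) * b th).
    by apply/funext => th; rewrite mulrC.
  exact: integrableZl_EFin.
move=> th Ith; rewrite -mulrBr Normc.normcM normc_real ger0_norm ?b0//.
apply: ler_wpM2l; first exact: b0.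
have [_ _ F1] := uF; have [_ _ G1] := uG.
apply: (le_trans (normcM_sub_le _ _ _ _ (F1 _) (G1 _))).
(* Collisions only lower frequencies, so a bound known up to [r] applies to both factors. *)
have in_r (y : R) : 0 <= y <= 1 -> 0 <= xi * y <= r.
  move=> /andP[y0 y1]; rewrite mulr_ge0//=; apply: le_trans xir.
  by rewrite ler_piMr.
have p1 : 0 <= p + 1 by rewrite addr_ge0// ltW.
apply: (le_trans (lerD (FG _ (in_r _ (powR_unit_itv _ _ p1 (cos_quadrant _ Ith))))
                       (FG _ (in_r _ (powR_unit_itv _ _ p1 (sin_quadrant _ Ith)))))).
rewrite -(powR_cos_sin p xi th p0 xi0 Ith).
by rewrite addrACA -mulrDr [2 * a]mulr_natl mulr2n lexx.
Qed.

End KacOperator.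

(** * Stability and mass conservation for the Kac equation with integrable kernel *)

Section KacStability.
Context {R : realType}.
Local Notation mu := (@lebesgue_measure R).
Local Notation normc := (@Normc.normc R).
Local Notation Re := complex.Re.
Local Notation I := (`[0%R, (pi / 2)%R]%classic : set R).

Lemma is_derive_relaxation (k s : R) :
  is_derive s 1 (fun s : R => k * (1 - expR (- (2 * s)))) (2 * k * expR (- (2 * s))).
Proof.
have d1 : is_derive s 1 (fun r : R => - (2 * r)) (- 2).
  have -> : (fun r : R => - (2 * r)) = (- 2) \*: (id : R -> R).
    by apply/funext => r /=; rewrite /GRing.scale/= mulNr.
  by apply: is_derive_eq (is_deriveZ (- 2) (is_derive_id s 1)) _; rewrite [_ *: _]mulr1.
have d2 := is_derive1_comp (is_derive_expR _) d1.
have d3 := is_deriveZ k (is_deriveB (is_derive_cst (1 : R) s 1) d2).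
by apply: is_derive_eq d3 _; rewrite /GRing.scale/=; ring.
Qed.

Lemma is_derive_exp_coeff (c s : R) n :
  is_derive s 1 (fun s : R => exp_coeff (c * s) n.+1) (c * exp_coeff (c * s) n).
Proof.
have d1 : is_derive s 1 (fun r : R => c * r) c.
  by apply: is_derive_eq (is_deriveZ c (is_derive_id s 1)) _; rewrite [_ *: _]mulr1.
have d2 := is_deriveZ (n.+1`!%:R^-1) (is_deriveX n.+1 d1).
have -> : (fun s : R => exp_coeff (c * s) n.+1) =
    n.+1`!%:R^-1 \*: (fun r : R => c * r) ^+ n.+1.
  by apply/funext => r; rewrite /exp_coeff/= /GRing.scale/= mulrC fctE.
apply: is_derive_eq d2 _.
rewrite /exp_coeff /GRing.scale/= factS natrM invfM.
by field; rewrite nat1r !pnatr_eq0 -lt0n fact_gt0.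
Qed.

Lemma exp_coeff_ge0 (x : R) n : 0 <= x -> 0 <= exp_coeff x n.
Proof. by move=> x0; rewrite /exp_coeff/= divr_ge0 ?exprn_ge0. Qed.

(* Iterating Duhamel's formula from the trivial bound 2 multiplies the error
   term by [4 * B * t / n] at the n-th step, while the bound
   [rho / 2 * (1 - expR (- (2 * t))) * xi `^ q] is reproduced exactly. *)
Lemma kac_stability (p r rho : R) (b : R -> R) (phi psi res : R -> R -> R[i]) :
  0 < p -> 0 <= rho ->
  mu.-integrable I (EFin \o b) -> (forall th, I th -> 0 <= b th) ->
  (forall t, 0 <= t -> unit_bounded (phi t)) ->
  (forall t, 0 <= t -> unit_bounded (psi t)) ->
  (forall t, 0 <= t -> phi t 0 = psi t 0) ->
  (forall xi, phi 0 xi = psi 0 xi) ->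
  (forall t xi, 0 <= t -> 0 < xi <= r ->
    has_derivative_in halfline (phi ^~ xi) t (kac_rhs p b (phi t) xi)) ->
  (forall t xi, 0 <= t -> 0 < xi <= r ->
    has_derivative_in halfline (psi ^~ xi) t
      (kac_rhs p b (psi t) xi + res t xi)) ->
  (forall t xi, 0 <= t -> 0 < xi <= r ->
    normc (res t xi) <= rho * xi `^ (2 / (p + 1)) * expR (- (2 * t))) ->
  forall t xi, 0 <= t -> 0 < xi <= r ->
  normc (phi t xi - psi t xi) <= rho / 2 * xi `^ (2 / (p + 1)).
Proof.
move=> p0 rho0 ib b0 uphi upsi e0 i0 dphi dpsi resb.
set B := \int[mu]_(th in I) b th.
have B0 : 0 <= B by apply: Rintegral_ge0.
set q := 2 / (p + 1) in resb *.
pose K t := rho / 2 * (1 - expR (- (2 * t))).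
have K0 t : 0 <= t -> 0 <= K t.
  move=> t0; rewrite mulr_ge0 ?divr_ge0// subr_ge0 -expR0 ler_expR.
  by rewrite oppr_le0 mulr_ge0.
(* [A n.+1] has derivative [4 * B * A n]: one factor 2 stands in front of the Kac integral, the
   other is the doubling in [normc_gain_integral_le]. *)
pose A n t : R := 2 * exp_coeff (4 * B * t) n.
have A0 n t : 0 <= t -> 0 <= A n t.
  by move=> t0; rewrite mulr_ge0// exp_coeff_ge0// !mulr_ge0.
have main n : forall t xi, 0 <= t -> 0 <= xi <= r ->
    normc (phi t xi - psi t xi) <= K t * xi `^ q + A n t.
  elim: n => [|n IH] t xi t0 /andP[xi0 xir].
    apply: (@le_trans _ _ 2).
      apply: (le_trans (normcB_le _ _)).
      have [_ _ /(_ xi) ?] := uphi _ t0; have [_ _ /(_ xi) ?] := upsi _ t0.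
      lra.
    rewrite /A /exp_coeff/= expr0 fact0 divr1 mulr1 lerDr.
    by rewrite mulr_ge0 ?K0 ?powR_ge0.
  (* Frequency 0 must belong to the induction, since the gain evaluates the transforms there at
     angle 0, but the equations are given only for positive frequencies; the agreement [e0] covers
     it. *)
  move: xi0; rewrite le_eqVlt => /predU1P[<-|xi0].
    rewrite e0// subrr Normc.normc0; apply: addr_ge0; last exact: A0.
    by apply: mulr_ge0; [exact: K0|exact: powR_ge0].
  have xib : 0 < xi <= r by rewrite xi0.
  pose du s := kac_rhs p b (phi s) xi - (kac_rhs p b (psi s) xi + res s xi).
  pose h s := K s * xi `^ q + A n.+1 s.
  pose dh s := rho * xi `^ q * expR (- (2 * s)) + 4 * B * A n s.
  apply: (@normc_comparison R (fun s => phi s xi - psi s xi) du h dh (2 * B) _ _ _ _ _ t t0).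
  - move=> s s0; apply: has_derivative_inB; [exact: dphi|exact: dpsi].
  - move=> s.
    have d1 := is_deriveZ (xi `^ q) (is_derive_relaxation (rho / 2) s).
    have d2 := is_deriveZ 2 (is_derive_exp_coeff (4 * B) s n).
    have -> : h = (xi `^ q) \*: (fun s : R => rho / 2 * (1 - expR (- (2 * s)))) +
        2 \*: (fun s : R => exp_coeff (4 * B * s) n.+1).
      by apply/funext => u; rewrite /h /K /A fctE /= /GRing.scale/= mulrC.
    apply: is_derive_eq (is_deriveD d1 d2) _.
    rewrite /dh /A /GRing.scale/=.
    by move: (xi `^ q) (expR _) (exp_coeff _ _) => x1 x2 x3; field.
  - by move=> s s0; rewrite addr_ge0 ?A0// mulr_ge0 ?K0 ?powR_ge0.
  - by rewrite i0 subrr.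
  - move=> s s0; rewrite /du !kac_rhs_gain ?uphi ?upsi//; try exact: uphi; try exact: upsi.
    rewrite -/B; set g1 := cintegral _ _; set g2 := cintegral _ _.
    (* With the rate [2 * B] the loss terms cancel, leaving only the gain difference and the
       residual. *)
    have -> : 2%:R * g1 - (2 * B)%:C * phi s xi
        - (2%:R * g2 - (2 * B)%:C * psi s xi + res s xi)
        + (2 * B)%:C * (phi s xi - psi s xi) = 2%:R * (g1 - g2) - res s xi by ring.
    apply: (le_trans (normcB_le _ _)).
    rewrite Normc.normcM.
    have -> : normc 2%:R = 2 :> R.
      by rewrite -(rmorph_nat (@real_complex R)) normc_real ger0_norm.
    have := normc_gain_integral_le p b (phi s) (psi s) xi (K s) (A n s) r p0 ib b0
      (uphi _ s0) (upsi _ s0) _ (fun x => IH s x s0).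
    rewrite (ltW xi0) xir -/B -/q -/g1 -/g2 => /(_ isT) gb.
    have rb := resb _ _ s0 xib.
    (* The two sides of the required inequality differ by the nonnegative slack
       [2 * B * A n.+1 s]. *)
    have An := mulr_ge0 B0 (A0 n.+1 s s0).
    rewrite /dh /h; move: gb rb An.
    move: (normc _) (normc _) (K s) (xi `^ q) (A n s) (A n.+1 s) (expR _).
    by move=> x1 x2 x3 x4 x5 x6 x7; nra.
move=> t xi t0 /andP[xi0 xir].
apply/ler_addgt0Pr => e e0'.
(* Up to the factor 2 these are the terms of a convergent exponential series. *)
have cA : A n t @[n --> \oo] --> 0.
  rewrite -(mulr0 2); apply: cvgMr.
  by apply: cvg_series_cvg_0; exact: is_cvg_series_exp_coeff.
have [n _ An] : \forall n \near \oo, `|A n t| < e.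
  move/cvgrPdist_lt : cA => /(_ _ e0').
  by apply: filterS => n; rewrite sub0r normrN.
apply: (le_trans (main n t xi t0 _)); first by rewrite (ltW xi0) xir.
apply: lerD.
  apply: ler_wpM2r; first exact: powR_ge0.
  apply: ler_piMr; first by rewrite divr_ge0.
  by rewrite gerBl expR_ge0.
by apply: ltW; apply: le_lt_trans (An n (leqnn n)); exact: ler_norm.
Qed.

(** At frequency 0 the equation closes into [m' = 2 * B * (m ^+ 2 - m)] for the mass [m]. The value
    1 is stationary, and a Gronwall argument for [(m - 1) ^+ 2] shows that a solution starting there
    stays there. *)
Lemma kac_mass (p : R) (b f0 : R -> R) (f : R -> R -> R) :
  mu.-integrable I (EFin \o b) -> (forall th, I th -> 0 <= b th) ->
  mu.-integrable setT (EFin \o f0) -> fourier f0 0 = 1 ->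
  kac_solution p b f0 f ->
  forall t, 0 <= t -> fourier (f t) 0 = 1.
Proof.
move=> ib b0 if0 f01 [C1 _ fi fd] T.
have ift t : 0 <= t -> mu.-integrable setT (EFin \o f t).
  by case: C1 => df /(_ t) h /h [].
set B := \int[mu]_(th in I) b th.
have B0 : 0 <= B by apply: Rintegral_ge0.
pose m t := Re (fourier (f t) 0).
have mE t : fourier (f t) 0 = (m t)%:C by rewrite /m fourier_at0.
have m0 : m 0 = 1 by rewrite /m (fourier_ae_eq (f 0) f0) ?f01//; exact: ift.
rewrite le_eqVlt => /predU1P[<-|T0]; first by rewrite mE m0.
pose dm t := 2 * B * (m t * m t - m t).
have dE t : kac_rhs p b (fourier (f t)) 0 = (dm t)%:C.
  rewrite /kac_rhs.
  have -> : (fun th => (b th)%:C * (fourier (f t) (0 * cos th `^ (p + 1)) *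
      fourier (f t) (0 * sin th `^ (p + 1)) - fourier (f t) 0)) =
      (fun th => (b th)%:C * (m t * m t - m t)%:C).
    by apply/funext => th; rewrite !mul0r !mE -rmorphM -rmorphB.
  by rewrite cintegral_scaled_cst// -/B /dm !rmorphM rmorph_nat mulrA.
have md t : 0 <= t -> r^-1 * (m (t + r) - m t)
    @[r --> within [set r | halfline (t + r)] 0^'] --> dm t.
  move=> t0; have := fd t 0 t0; rewrite dE => /(halfline_derivative_dot _ _ _ 1 0).
  by under eq_fun do rewrite !mul1r !mul0r !addr0; rewrite mul1r mul0r addr0.
have cm := halfline_within_continuous _ _ _ T0 md.
(* The square [w] of [m - 1] satisfies [w' = 4 * B * m * w]; the maximum of [m] on [[0, T]] bounds
   this rate by the constant [4 * B * m c]. *)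
have [c _ cM] := EVT_max (ltW T0) cm.
have d1 (s : R) : 0 < s < T -> is_derive s 1 m (dm s).
  by move=> /andP[s0 _]; apply: halfline_is_derive => //; exact: md (ltW s0).
pose w s := (m s - 1) * (m s - 1).
pose dw s := 2 * ((m s - 1) * dm s).
have : w T <= (cst 0 : R -> R) T.
  apply: (@linear_comparison R w dw (cst 0) (cst 0) (- (4 * B * m c))) => //.
  - move=> s /d1 ds.
    have d2 := is_deriveB ds (is_derive_cst (1 : R) s 1).
    apply: is_derive_eq (is_deriveM d2 d2) _.
    rewrite /dw !fctE /GRing.scale/=; ring.
  - by move=> s; apply: cvgM; (apply: cvgB; [exact: cm|exact: cvg_cst]).
  - by rewrite /w m0 subrr mul0r.
  - move=> s /andP[s0 sT]; rewrite /dw /dm /w /= mulr0 addr0.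
    have ms : m s <= m c by apply: cM; rewrite in_itv/= !ltW.
    have -> : 2 * ((m s - 1) * (2 * B * (m s * m s - m s))) +
        - (4 * B * m c) * ((m s - 1) * (m s - 1)) =
        (4 * B * (m s - 1) ^+ 2) * (m s - m c) by ring.
    apply: mulr_ge0_le0; last by rewrite subr_le0.
    by apply: mulr_ge0; [rewrite mulr_ge0|exact: sqr_ge0].
rewrite /w /= -expr2 => w0.
have /eqP : (m T - 1) ^+ 2 = 0 by apply/eqP; rewrite eq_le w0 sqr_ge0.
by rewrite expf_eq0/= subr_eq0 mE => /eqP ->.
Qed.

End KacStability.

(** * The Kac operator approaches the Fokker-Planck operator for grazing collisions *)

Section GrazingResidual.
Context {R : realType}.
Local Notation mu := (@lebesgue_measure R).
Local Notation normc := (@Normc.normc R).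
Local Notation Re := complex.Re.
Local Notation Im := complex.Im.
Local Notation I := (`[0%R, (pi / 2)%R]%classic : set R).

Lemma MVT_powR (f df : R -> R) (q x y : R) : 0 < q -> 0 < x -> x < y ->
  (forall z : R, 0 < z -> is_derive z 1 f (df z)) ->
  exists2 z, x < z < y &
    f y - f x = (y `^ q - x `^ q) / q * (df z / z `^ (q - 1)).
Proof.
move=> q0 x0 xy fd.
have gd (z : R) : 0 < z -> is_derive z 1 (fun z => z `^ q) (q * z `^ (q - 1)).
  exact: is_derive1_powR.
have pos z : z \in `]x, y[ -> 0 < z.
  by rewrite in_itv/= => /andP[xz _]; exact: lt_trans xz.
have posc z : z \in `[x, y] -> 0 < z.
  by rewrite in_itv/= => /andP[xz _]; exact: lt_le_trans xz.
have [] := @cauchy_MVT R f df (fun z => z `^ q) (fun z => q * z `^ (q - 1)) x y xy.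
- by apply: derivable_within_continuous => z /posc/fd[].
- by apply: derivable_within_continuous => z /posc/gd[].
- by move=> z /pos/fd.
- by move=> z /pos/gd.
- by move=> z /pos z0; rewrite mulf_neq0 ?gt_eqF ?powR_gt0.
move=> z zI /esym/eqP.
have z0 := pos _ zI.
have zq0 : z `^ (q - 1) != 0 by rewrite gt_eqF ?powR_gt0.
have yx0 : y `^ q - x `^ q != 0.
  rewrite subr_eq0 gt_eqF//; apply: gt0_ltr_powR => //; rewrite nnegrE ltW//.
  exact: lt_trans xy.
rewrite (eqr_div _ _ yx0) ?mulf_neq0 ?(gt_eqF q0)// => /eqP fE.
exists z; first by move: zI; rewrite in_itv.
apply: (@mulIf _ (q * z `^ (q - 1))); first by rewrite mulf_neq0 ?(gt_eqF q0).
rewrite fE; field; by rewrite zq0 gt_eqF.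
Qed.

(* In the variable [x `^ q] the function has derivative [dphi x / (q * x `^ (q - 1))],
   which is Hoelder continuous by assumption. *)
Lemma powR_increment (phi dphi : R -> R[i]) (q x y e : R) :
  0 < q -> 0 < x -> x < y ->
  (forall z, 0 < z -> has_derivative_in setT phi z (dphi z)) ->
  (forall z, x < z < y ->
    normc (dphi z / (z `^ (q - 1))%:C - dphi y / (y `^ (q - 1))%:C) <= e) ->
  normc (phi y - phi x - ((y `^ q - x `^ q) / q)%:C * (dphi y / (y `^ (q - 1))%:C))
    <= 2 * e * ((y `^ q - x `^ q) / q).
Proof.
move=> q0 x0 xy dp de.
have D0 : 0 <= (y `^ q - x `^ q) / q.
  rewrite divr_ge0 ?(ltW q0)// subr_ge0; apply: ge0_ler_powR; rewrite ?nnegrE ltW//.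
  exact: lt_trans xy.
set D := (_ - _) / q in D0 *.
have dr (z : R) : 0 < z -> is_derive z 1 (fun z => Re (phi z)) (Re (dphi z)).
  by move=> z0; have /has_derivative_inP[] := dp _ z0.
have di (z : R) : 0 < z -> is_derive z 1 (fun z => Im (phi z)) (Im (dphi z)).
  by move=> z0; have /has_derivative_inP[] := dp _ z0.
have Re_div (u : R[i]) (k : R) : Re (u / k%:C) = Re u / k.
  by rewrite -fmorphV; case: u => a c /=; rewrite mulr0 subr0.
have Im_div (u : R[i]) (k : R) : Im (u / k%:C) = Im u / k.
  by rewrite -fmorphV; case: u => a c /=; rewrite mulr0 add0r.
have Re_scale (u v w : R[i]) (k : R) : Re (u - v - k%:C * w) = Re u - Re v - k * Re w.
  by case: u => ? ?; case: v => ? ?; case: w => ? ? /=; rewrite mul0r subr0.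
have Im_scale (u v w : R[i]) (k : R) : Im (u - v - k%:C * w) = Im u - Im v - k * Im w.
  by case: u => ? ?; case: v => ? ?; case: w => ? ? /=; rewrite mul0r addr0.
(* Real and imaginary parts have different intermediate points, which is where the factor 2 in the
   bound comes from. *)
apply: (le_trans (normc_le_abs _)).
have -> : 2 * e * D = D * e + D * e by ring.
apply: lerD.
- have [z zI fE] := MVT_powR _ _ _ _ _ q0 x0 xy dr.
  rewrite Re_scale fE -/D -mulrBr normrM (ger0_norm D0) ler_wpM2l//.
  apply: le_trans (de _ zI); apply: le_trans (abs_Re_le_normc _).
  by rewrite -!Re_div; case: (dphi z / _) => ? ?; case: (dphi y / _).
- have [z zI fE] := MVT_powR _ _ _ _ _ q0 x0 xy di.
  rewrite Im_scale fE -/D -mulrBr normrM (ger0_norm D0) ler_wpM2l//.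
  apply: le_trans (de _ zI); apply: le_trans (abs_Im_le_normc _).
  by rewrite -!Im_div; case: (dphi z / _) => ? ?; case: (dphi y / _).
Qed.

Lemma at_right0P (P : R -> Prop) : (\forall x \near 0^'+, P x) ->
  exists2 d : R, 0 < d & forall x, 0 < x < d -> P x.
Proof.
move=> [d /= d0 dP]; exists d => // x /andP[x0 xd]; apply: dP => //=.
by rewrite sub0r normrN gtr0_norm.
Qed.

Lemma quotient_limit_bound (phi : R -> R[i]) (q alpha e : R) : 0 < e ->
  ((1 - phi x) / (x `^ q)%:C : R[i]^o) @[x --> 0^'+] --> (alpha%:C : R[i]^o) ->
  exists2 d : R, 0 < d & forall x, 0 < x < d ->
    normc (1 - phi x - (alpha * x `^ q)%:C) <= e * x `^ q.
Proof.
move=> e0 /cvgrPdist_lt /(_ e%:C); rewrite ltcR => /(_ e0) /at_right0P[d d0 dP].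
exists d => // x xd; have /andP[x0 _] := xd.
have := dP _ xd; rewrite /Num.Def.normr/= ltcR => lt_e.
have xq0 : (x `^ q)%:C != 0 by rewrite fmorph_eq0 gt_eqF ?powR_gt0.
have -> : 1 - phi x - (alpha * x `^ q)%:C =
    - ((alpha%:C - (1 - phi x) / (x `^ q)%:C) * (x `^ q)%:C).
  by rewrite rmorphM mulrBl divfK// opprB.
rewrite normc_opp Normc.normcM normc_real (ger0_norm (powR_ge0 _ _)).
by rewrite ler_wpM2r ?powR_ge0// ltW.
Qed.

Lemma grazing_residual_pointwise (p alpha delta r om : R)
    (phi dphi : R -> R[i]) :
  0 < p <= 1 -> 0 < alpha -> 0 < delta -> 0 < r -> 0 < om ->
  (forall x, normc (phi x) <= 1) ->
  ((1 - phi x) / (x `^ (2 / (p + 1)))%:C : R[i]^o)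
    @[x --> 0^'+] --> (alpha%:C : R[i]^o) ->
  (forall x, 0 < x -> has_derivative_in setT phi x (dphi x)) ->
  (exists2 K : R, 0 < K & forall x y, 0 < x <= r -> 0 < y <= r -> x != y ->
    normc (dphi x / (x `^ ((1 - p) / (p + 1)))%:C
           - dphi y / (y `^ ((1 - p) / (p + 1)))%:C)
      / `|x - y| `^ delta <= K) ->
  exists2 s0 : R, 0 < s0 & forall eta th, 0 < eta <= r -> I th ->
    0 < sin th < s0 ->
    normc (gain p phi eta th - phi eta
      + (sin th ^+ 2)%:C * ((alpha * eta `^ (2 / (p + 1)))%:C * phi eta
                            + ((p + 1) / 2 * eta)%:C * dphi eta))
    <= om * (sin th ^+ 2 * eta `^ (2 / (p + 1))).
Proof.
move=> /andP[p0 p1] al0 de0 r0 om0 phi1 hA hD [K K0 hB].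
have p11 : 1 <= p + 1 by lra.
have p12 : p + 1 <= 2 by lra.
set q := 2 / (p + 1) in hA *.
have pp0 : 0 < p + 1 by rewrite addr_gt0.
have q0 : 0 < q by rewrite divr_gt0.
have qE : (1 - p) / (p + 1) = q - 1 by rewrite /q; field; rewrite gt_eqF.
rewrite qE in hB.
(* One third for each of the three errors in the final decomposition. *)
pose o3 := om / 3.
have o30 : 0 < o3 by rewrite divr_gt0.
have [d1 d10 hA1] := quotient_limit_bound _ _ _ _ o30 hA.
have rq0 : 0 < r `^ q by rewrite powR_gt0.
pose g x := dphi x / (x `^ (q - 1))%:C.
have hB' x y : 0 < x <= r -> 0 < y <= r -> x != y ->
    normc (g x - g y) <= K * `|x - y| `^ delta.
  move=> xr yr xy; rewrite -ler_pdivrMr ?hB//.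
  by rewrite powR_gt0// normr_gt0 subr_eq0.
(* Hoelder continuity up to [r] bounds [g] near 0 as well, by comparison with its value at [r]. *)
pose M := normc (g r) + K * r `^ delta.
have gM x : 0 < x <= r -> normc (g x) <= M.
  move=> xr; have /andP[x0 xr'] := xr.
  have [->|xnr] := eqVneq x r; first by rewrite lerDl mulr_ge0 ?powR_ge0 ?ltW.
  have -> : g x = g r + (g x - g r) by rewrite addrC subrK.
  apply: (le_trans (normcD_le _ _)); rewrite lerD2l.
  have rr : 0 < r <= r by rewrite r0 lexx.
  apply: (le_trans (hB' _ _ xr rr xnr)).
  rewrite ler_wpM2l ?(ltW K0)//; apply: ge0_ler_powR; rewrite ?nnegrE ?(ltW r0) ?(ltW de0)//.
  rewrite ler0_norm ?subr_le0// opprB lerBlDr lerDl; exact: ltW.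
have M0 : 0 <= M.
  by rewrite addr_ge0 ?normc_ge0 ?mulr_ge0 ?powR_ge0 ?(ltW K0).
(* (2 * e) / q = o3 *)
pose e := o3 * q / 2.
have e0 : 0 < e by rewrite !mulr_gt0// invr_gt0.
(* The thresholds on [sin th]: [s1] brings the sine argument into the range of the expansion at 0,
   [s2] makes the Hoelder modulus at distance [r * sin th] at most [e], and [s3] makes [alpha] times
   the increment from the cosine argument to [eta] at most [o3]. *)
pose s1 := d1 / r.
pose s2 := (e / K) `^ (delta^-1) / r.
pose C := alpha * (r `^ q * (o3 + M / q)).
have C0 : 0 < C.
  by rewrite !mulr_gt0// ltr_wpDr// divr_ge0// ltW.
pose s3 := o3 / C.
exists (Num.min 1 (Num.min s1 (Num.min s2 s3))).
  rewrite !lt_min ltr01 !divr_gt0//= ?powR_gt0//; exact: divr_gt0.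
move=> eta th /andP[eta0 etar] Ith /andP[sg0].
rewrite !lt_min => /and4P[sg1 sgs1 sgs2 sgs3].
set sg := sin th in sg0 sg1 sgs1 sgs2 sgs3 *.
have sg2 : sg ^+ 2 <= sg by rewrite expr2 ler_piMl ?ltW.
have sg20 : 0 < sg ^+ 2 by rewrite exprn_gt0.
have /andP[c0 c1] := cos_quadrant _ Ith.
have cs : cos th ^+ 2 = 1 - sg ^+ 2 by rewrite /sg cos2sin2.
have cgt0 : 0 < cos th.
  rewrite lt_neqAle c0 andbT; apply/eqP => c00; move: cs; rewrite -c00 expr0n/=.
  by move: sg2 sg1; lra.
have clt1 : cos th < 1.
  rewrite lt_neqAle c1 andbT; apply/eqP => c11; move: cs; rewrite c11 expr1n.
  by move: sg20; lra.
set y := eta `^ q.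
have y0 : 0 < y by rewrite powR_gt0.
have yr : y <= r `^ q.
  by apply: ge0_ler_powR; rewrite ?nnegrE ?(ltW q0) ?(ltW eta0) ?(ltW r0).
pose xs := eta * sg `^ (p + 1); pose xc := eta * cos th `^ (p + 1).
have xsq : xs `^ q = sg ^+ 2 * y.
  by rewrite powRM ?powR_ge0 ?(ltW eta0)// powR_collision ?(ltW sg0)// mulrC.
have xcq : xc `^ q = cos th ^+ 2 * y.
  by rewrite powRM ?powR_ge0 ?(ltW eta0)// powR_collision// mulrC.
have xs0 : 0 < xs by rewrite mulr_gt0 ?powR_gt0.
have xc0 : 0 < xc by rewrite mulr_gt0 ?powR_gt0.
have xsd : xs < d1.
  apply: (@le_lt_trans _ _ (r * sg)); last by rewrite mulrC -ltr_pdivlMr.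
  apply: ler_pM => //; rewrite ?(ltW eta0) ?powR_ge0//.
  by apply: ge1r_powR; rewrite ?sg0 ?(ltW sg1).
have c2le : cos th ^+ 2 <= cos th `^ (p + 1).
  rewrite -powR_mulrn//; apply: ger_powR => //; by rewrite cgt0.
have xclt : xc < eta.
  rewrite /xc gtr_pMr//; have := @gt0_ltr_powR R _ pp0 (cos th) 1.
  by rewrite !nnegrE powR1; apply.
have xcd : eta - xc <= r * sg.
  have -> : eta - xc = eta * (1 - cos th `^ (p + 1)) by rewrite mulrBr mulr1.
  apply: ler_pM => //; rewrite ?(ltW eta0)// ?subr_ge0.
    by have /andP[] := powR_unit_itv _ _ (ltW pp0) (cos_quadrant _ Ith).
  by apply: le_trans sg2; rewrite lerBlDr addrC -lerBlDr -cs.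
have h1 : normc (1 - phi xs - (alpha * (sg ^+ 2 * y))%:C) <= o3 * (sg ^+ 2 * y).
  by rewrite -xsq; apply: hA1; rewrite xs0.
have h2 : normc (phi eta - phi xc - (sg ^+ 2 * y / q)%:C * g eta) <=
    o3 * (sg ^+ 2 * y).
  have DE : y - xc `^ q = sg ^+ 2 * y by rewrite xcq cs; ring.
  have := powR_increment phi dphi q xc eta e q0 xc0 xclt hD.
  rewrite -/y DE.
  have -> : 2 * e * (sg ^+ 2 * y / q) = o3 * (sg ^+ 2 * y).
    by rewrite /e; field; rewrite gt_eqF.
  apply => z /andP[xz ze].
  have zr : 0 < z <= r.
    by rewrite (lt_trans xc0 xz)/=; apply: le_trans etar; exact: ltW.
  have er : 0 < eta <= r by rewrite eta0.
  apply: (le_trans (hB' _ _ zr er (negbT (lt_eqF ze)))).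
  rewrite -ler_pdivlMl// mulrC.
  apply: (@le_trans _ _ ((e / K) `^ delta^-1 `^ delta)); last first.
    rewrite -powRrM mulVf ?gt_eqF// powRr1//; apply: divr_ge0; exact: ltW.
  apply: ge0_ler_powR; rewrite ?nnegrE ?powR_ge0 ?(ltW de0)//.
  rewrite ltr0_norm ?subr_lt0// opprB.
  apply: (@le_trans _ _ (eta - xc)); first by rewrite lerD2l lerN2 ltW.
  apply: (le_trans xcd); rewrite mulrC -ler_pdivlMr//; exact: ltW.
have D2 : (sg ^+ 2)%:C * (((p + 1) / 2 * eta)%:C * dphi eta) =
    (sg ^+ 2 * y / q)%:C * g eta.
  have yE : y = eta `^ (q - 1) * eta.
    by rewrite mulrC /y -[in LHS](mulr_powRB1 (ltW eta0) q0).
  have e10 : (eta `^ (q - 1))%:C != 0 by rewrite fmorph_eq0 gt_eqF ?powR_gt0.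
  rewrite /g yE (_ : (p + 1) / 2 = q^-1); last by rewrite /q invf_div.
  have gen (z1 z2 z3 z4 z5 : R[i]) : z5 != 0 ->
    z1 * (z2 * z3 * z4) = z1 * (z5 * z3) * z2 * (z4 / z5) by move=> ?; field.
  by rewrite !rmorphM /=; exact: gen.
set u := phi xc; set v := phi xs; set w := phi eta.
have gE : gain p phi eta th = u * v by [].
have h3 : normc (w - u) <= sg * (r `^ q * (o3 + M / q)).
  have -> : w - u = (w - u - (sg ^+ 2 * y / q)%:C * g eta) +
    (sg ^+ 2 * y / q)%:C * g eta by rewrite subrK.
  apply: (le_trans (normcD_le _ _)).
  rewrite Normc.normcM normc_real ger0_norm; last first.
    by rewrite !mulr_ge0 ?invr_ge0 ?ltW.
  apply: (@le_trans _ _ ((sg ^+ 2 * y) * (o3 + M / q))).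
    rewrite mulrDr [_ * o3]mulrC; apply: lerD => //.
    rewrite [leLHS]mulrAC -[leLHS]mulrA; apply: ler_wpM2l.
      by apply: mulr_ge0; exact: ltW.
    by apply: ler_wpM2r; [rewrite invr_ge0 ltW|apply: gM; rewrite eta0].
  rewrite [leRHS]mulrA; apply: ler_wpM2r; last first.
    by apply: ler_pM => //; exact: ltW.
  by apply: addr_ge0; [exact: ltW|rewrite divr_ge0// ltW].
have h4 : alpha * normc (w - u) <= o3.
  apply: (@le_trans _ _ (sg * C)); last by rewrite -ler_pdivlMr// ltW.
  by rewrite /C mulrCA; apply: ler_wpM2l => //; exact: ltW.
rewrite gE mulrDr D2.
(* Three errors: the expansion of [v] at 0, the replacement of [u] by [w] in the term with [alpha],
   and the Taylor remainder of [phi] between the cosine argument and [eta]. *)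
have -> : u * v - w + ((sg ^+ 2)%:C * ((alpha * y)%:C * w) + (sg ^+ 2 * y / q)%:C * g eta) =
  - (u * (1 - v - (alpha * (sg ^+ 2 * y))%:C)) +
  (alpha * (sg ^+ 2 * y))%:C * (w - u) -
  (w - u - (sg ^+ 2 * y / q)%:C * g eta).
  rewrite !rmorphM /=; ring.
apply: (le_trans (normcB_le _ _)).
have := normcD_le (- (u * (1 - v - (alpha * (sg ^+ 2 * y))%:C)))
  ((alpha * (sg ^+ 2 * y))%:C * (w - u)).
rewrite normc_opp !Normc.normcM normc_real ger0_norm; last first.
  by rewrite !mulr_ge0 ?ltW.
have h5 : normc u * normc (1 - v - (alpha * (sg ^+ 2 * y))%:C) <= o3 * (sg ^+ 2 * y).
  apply: le_trans h1; rewrite ler_piMl ?normc_ge0//; exact: phi1.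
have h6 : alpha * (sg ^+ 2 * y) * normc (w - u) <= o3 * (sg ^+ 2 * y).
  by rewrite mulrAC ler_wpM2r// mulr_ge0 ?ltW.
have -> : om * (sg ^+ 2 * y) = o3 * (sg ^+ 2 * y) + o3 * (sg ^+ 2 * y) +
   o3 * (sg ^+ 2 * y) by rewrite /o3; field.
by move=> h7; apply: lerD h2; apply: (le_trans h7); exact: lerD.
Qed.

(** Since [b th * sin th ^+ 2] has integral 1, the Fokker-Planck term can be moved under the angular
    integral, where the pointwise estimate applies and integrates to [om] times the weight. *)
Lemma grazing_residual (p alpha om s0 : R) (b : R -> R) (phi dphi : R -> R[i])
    (eta : R) :
  mu.-integrable I (EFin \o b) -> (forall th, I th -> 0 <= b th) ->
  (\int[mu]_(th in I) (b th * sin th ^+ 2)%:E = 1)%E ->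
  (forall th, I th -> b th != 0 -> 0 < sin th < s0) ->
  unit_bounded phi ->
  (forall th, I th -> 0 < sin th < s0 ->
    normc (gain p phi eta th - phi eta
      + (sin th ^+ 2)%:C * ((alpha * eta `^ (2 / (p + 1)))%:C * phi eta
                            + ((p + 1) / 2 * eta)%:C * dphi eta))
    <= om * (sin th ^+ 2 * eta `^ (2 / (p + 1)))) ->
  normc (- (2 * alpha * eta `^ (2 / (p + 1)))%:C * phi eta
         - ((p + 1) * eta)%:C * dphi eta - kac_rhs p b phi eta)
    <= 2 * om * eta `^ (2 / (p + 1)).
Proof.
move=> ib b0 bs1 bsupp uphi hom.
set q := 2 / (p + 1) in hom *.
set z := (alpha * eta `^ q)%:C * phi eta + ((p + 1) / 2 * eta)%:C * dphi eta in hom.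
have ibs : mu.-integrable I (EFin \o (fun th => b th * sin th ^+ 2)).
  have -> : (fun th => b th * sin th ^+ 2) = (fun th => sin th ^+ 2 * b th).
    by apply/funext => th; rewrite mulrC.
  apply: (@integrable_mul_bounded _ _ _ _ 1) => //.
    apply: (@measurable_funS _ _ _ _ setT) => //.
    apply: measurable_funX; apply: continuous_measurable_fun; exact: continuous_sin.
  by move=> x _; rewrite normrX exprn_ile1// abs_sin_le1.
have bs : \int[mu]_(th in I) (b th * sin th ^+ 2) = 1 by rewrite /Rintegral bs1.
have cF : cintegrable I (fun th => (b th)%:C * gain p phi eta th - (b th)%:C * phi eta).
  by apply: cintegrableB => //; [exact: cintegrable_gain|exact: cintegrable_cst].
have cG : cintegrable I (fun th => (b th * sin th ^+ 2)%:C * (- z)).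
  exact: cintegrable_cst.
have -> : - (2 * alpha * eta `^ q)%:C * phi eta - ((p + 1) * eta)%:C * dphi eta
    - kac_rhs p b phi eta =
  - (2%:R * cintegral I (fun th => ((b th)%:C * gain p phi eta th - (b th)%:C * phi eta)
     - (b th * sin th ^+ 2)%:C * (- z))).
  rewrite cintegralB// cintegral_scaled_cst// bs /kac_rhs.
  set J := cintegral _ _; set J' := cintegral _ _.
  have -> : J = J' by apply: eq_cintegral => th _; rewrite mulrBr.
  have -> : - (2%:R * (J' - 1%:C * - z)) = - (2%:R * z) - 2%:R * J' by rewrite rmorph1; ring.
  congr (_ - _); rewrite /z.
  have -> : (p + 1) * eta = 2%:R * ((p + 1) / 2 * eta) by field.
  by rewrite !rmorphM /= !rmorph_nat; ring.
rewrite normc_opp Normc.normcM.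
have -> : normc 2%:R = 2 :> R.
  by rewrite -(rmorph_nat (@real_complex R)) normc_real ger0_norm.
rewrite -mulrA; apply: ler_wpM2l => //.
have -> : om * eta `^ q =
    \int[mu]_(th in I) (b th * sin th ^+ 2 * (om * eta `^ q)).
  by rewrite RintegralZr// bs mul1r.
apply: normc_cintegral_le => //.
- exact: cintegrableB.
- have -> : (fun th => b th * sin th ^+ 2 * (om * eta `^ q)) =
     (fun th => (om * eta `^ q) * (b th * sin th ^+ 2)).
    by apply/funext => th; rewrite mulrC.
  exact: integrableZl_EFin.
(* The pointwise estimate is available only for small positive sines; elsewhere the kernel, hence
   the integrand, vanishes. *)
move=> th Ith; have [->|bth] := eqVneq (b th) 0.
  by rewrite !mul0r !subr0 Normc.normc0.
have -> : (b th)%:C * gain p phi eta th - (b th)%:C * phi eta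
    - (b th * sin th ^+ 2)%:C * - z =
  (b th)%:C * (gain p phi eta th - phi eta + (sin th ^+ 2)%:C * z).
  by rewrite rmorphM; ring.
rewrite Normc.normcM normc_real ger0_norm ?b0// -mulrA; apply: ler_wpM2l; first exact: b0.
by apply: (le_trans (hom _ Ith (bsupp _ Ith bth))); rewrite mulrCA.
Qed.

End GrazingResidual.

(** * The explicit Fokker-Planck flow and its compatibility with collisions *)

Section FokkerPlanckScaling.
Context {R : realType}.
Local Notation mu := (@lebesgue_measure R).
Local Notation normc := (@Normc.normc R).
Local Notation Re := complex.Re.
Local Notation Im := complex.Im.
Local Notation I := (`[0%R, (pi / 2)%R]%classic : set R).
Implicit Types (p alpha t xi : R) (f g : R -> R).

(** This is the factor [E] of the overview; [fp_shift] below is the ratio of [eta] to [xi]. *)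
Definition fp_damping p alpha t xi : R :=
  expR (- (alpha * `|xi| `^ (2 / (p + 1)) * (1 - expR (- (2 * t))))).

Definition fp_shift p t : R := expR (- ((p + 1) * t)).

Lemma fp_hatE p alpha (f0 : R -> R) xi t : fp_hat p alpha f0 xi t =
  fourier f0 (xi * fp_shift p t) * (fp_damping p alpha t xi)%:C.
Proof. by []. Qed.

Lemma fp_damping_le1 p alpha t xi : 0 <= alpha -> 0 <= t ->
  fp_damping p alpha t xi <= 1.
Proof.
move=> al0 t0; rewrite -expR0 ler_expR oppr_le0 mulr_ge0//.
  by rewrite mulr_ge0 ?powR_ge0.
by rewrite subr_ge0 -expR0 ler_expR oppr_le0 mulr_ge0.
Qed.

(** The exponent is linear in the weight, and the weight is additive along collisions by
    [powR_cos_sin]. *)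
Lemma fp_dampingM p alpha t xi th : 0 < p -> 0 <= xi -> I th ->
  fp_damping p alpha t (xi * cos th `^ (p + 1)) *
  fp_damping p alpha t (xi * sin th `^ (p + 1)) = fp_damping p alpha t xi.
Proof.
move=> p0 xi0 Ith; rewrite /fp_damping -expRD; congr expR.
rewrite !ger0_norm ?mulr_ge0 ?powR_ge0// -(powR_cos_sin p xi th p0 xi0 Ith).
by move: (powR (_ * _) _) (powR (_ * _) _) (expR _) => x1 x2 x3; ring.
Qed.

Lemma powR_fp_shift p t xi : 0 < p -> 0 <= xi ->
  (xi * fp_shift p t) `^ (2 / (p + 1)) = xi `^ (2 / (p + 1)) * expR (- (2 * t)).
Proof.
move=> p0 xi0; rewrite powRM ?expR_ge0//; congr (_ * _).
rewrite /fp_shift -expRM; congr expR; field.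
by rewrite gt_eqF// addr_gt0.
Qed.

(** The decay of the damping contributes the rate [2 * alpha * xi]^ q * expR (- (2 *
    t))[, which is]2 * alpha * eta [^ q]. The time derivative is thus the damping times a
    time-independent operator applied to the initial transform at [eta], the same form as in
    [kac_rhs_fp_hat]. *)
Lemma fp_hat_derivative p alpha (f0 : R -> R) (df0 : R -> R[i]) xi t : 0 < p -> 0 < xi ->
  (forall x, x != 0 -> has_derivative_in setT (fourier f0) x (df0 x)) ->
  let eta := xi * fp_shift p t in
  has_derivative_in halfline (fp_hat p alpha f0 xi) t
    ((fp_damping p alpha t xi)%:C *
     (- (2 * alpha * eta `^ (2 / (p + 1)))%:C * fourier f0 eta
      - ((p + 1) * eta)%:C * df0 eta)).
Proof.
move=> p0 xi0 df eta; apply: has_derivative_inW; apply/has_derivative_inP.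
have eta0 : eta != 0 by rewrite mulf_neq0 ?gt_eqF ?expR_gt0.
have /has_derivative_inP[dr di] := df _ eta0.
have reE (z : R[i]) (k : R) : Re (z * k%:C) = Re z * k.
  by case: z => a c /=; rewrite mulr0 subr0.
have imE (z : R[i]) (k : R) : Im (z * k%:C) = Im z * k.
  by case: z => a c /=; rewrite mulr0 add0r.
rewrite (powR_fp_shift p t xi p0 (ltW xi0)); set q := 2 / (p + 1).
split.
- under eq_fun do rewrite /fp_hat reE.
  apply: is_derive_eq (is_derive_fp_t alpha (`|xi| `^ q) dr) _.
  rewrite /fp_damping -/q -/eta (gtr0_norm xi0) /eta /fp_shift.
  by case: (df0 _) => ? ?; case: (fourier _ _) => ? ? /=; ring.
- under eq_fun do rewrite /fp_hat imE.
  apply: is_derive_eq (is_derive_fp_t alpha (`|xi| `^ q) di) _.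
  rewrite /fp_damping -/q -/eta (gtr0_norm xi0) /eta /fp_shift.
  by case: (df0 _) => ? ?; case: (fourier _ _) => ? ? /=; ring.
Qed.

Lemma unit_bounded_fourier g : mu.-integrable setT (EFin \o g) ->
  {ae mu, forall v, 0 <= g v} -> fourier g 0 = 1 -> unit_bounded (fourier g).
Proof.
move=> ig g0 g1; split.
- by apply: continuous_measurable_fun; exact: continuous_Re_fourier.
- by apply: continuous_measurable_fun; exact: continuous_Im_fourier.
- move=> x; apply: (le_trans (normc_fourier_le _ _ ig g0)).
  by move: g1; rewrite fourier_at0 => -[->].
Qed.

Lemma unit_bounded_fp_hat p alpha (f0 : R -> R) t : 0 <= alpha -> 0 <= t ->
  unit_bounded (fourier f0) -> unit_bounded (fun xi => fp_hat p alpha f0 xi t).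
Proof.
move=> al0 t0 [mr mi f1].
have ms : measurable_fun setT (fun xi : R => xi * fp_shift p t).
  exact: measurable_funM.
have md : measurable_fun setT (fp_damping p alpha t).
  rewrite /fp_damping; apply: measurableT_comp => //.
  apply: measurableT_comp => //; apply: measurable_funM => //.
  apply: measurable_funM => //.
  apply: (measurableT_comp (measurable_powR (2 / (p + 1)))).
  exact: normr_measurable.
split.
- have -> : (fun xi => Re (fp_hat p alpha f0 xi t)) =
    (fun xi => Re (fourier f0 (xi * fp_shift p t)) * fp_damping p alpha t xi).
    apply/funext => xi; rewrite fp_hatE; case: (fourier _ _) => ? ? /=.
    by rewrite mulr0 subr0.
  by apply: measurable_funM => //; exact: (measurableT_comp mr ms).
- have -> : (fun xi => Im (fp_hat p alpha f0 xi t)) =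
    (fun xi => Im (fourier f0 (xi * fp_shift p t)) * fp_damping p alpha t xi).
    apply/funext => xi; rewrite fp_hatE; case: (fourier _ _) => ? ? /=.
    by rewrite mulr0 add0r.
  by apply: measurable_funM => //; exact: (measurableT_comp mi ms).
- move=> xi; rewrite fp_hatE Normc.normcM normc_real ger0_norm ?expR_ge0//.
  by apply: mulr_ile1; rewrite ?normc_ge0 ?expR_ge0 ?f1 ?fp_damping_le1.
Qed.

(** By [fp_dampingM] the gain carries the same damping as the loss, and the shift commutes with the
    collision scalings. *)
Lemma kac_rhs_fp_hat p alpha (f0 : R -> R) (b : R -> R) xi t :
  0 < p -> 0 <= xi -> mu.-integrable I (EFin \o b) ->
  unit_bounded (fourier f0) ->
  kac_rhs p b (fun x => fp_hat p alpha f0 x t) xi =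
  (fp_damping p alpha t xi)%:C * kac_rhs p b (fourier f0) (xi * fp_shift p t).
Proof.
move=> p0 xi0 ib uf; rewrite /kac_rhs mulrCA -cintegralM_real//; last first.
  have -> : (fun th => (b th)%:C *
      (fourier f0 (xi * fp_shift p t * cos th `^ (p + 1)) *
       fourier f0 (xi * fp_shift p t * sin th `^ (p + 1)) -
       fourier f0 (xi * fp_shift p t))) =
     (fun th => (b th)%:C * gain p (fourier f0) (xi * fp_shift p t) th -
       (b th)%:C * fourier f0 (xi * fp_shift p t)).
    by apply/funext => th; rewrite mulrBr.
  by apply: cintegrableB => //; [exact: cintegrable_gain|exact: cintegrable_cst].
congr (_ * _); apply: eq_cintegral => th Ith.
rewrite !fp_hatE -(fp_dampingM p alpha t xi th p0 xi0 Ith) rmorphM /=.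
rewrite ![xi * _ * fp_shift p t]mulrAC.
have gen (z u v w k l : R[i]) :
  z * (u * k * (v * l) - w * (k * l)) = k * l * (z * (u * v - w)) by ring.
exact: gen.
Qed.

Lemma fp_hatN p alpha (f0 : R -> R) xi t : mu.-integrable setT (EFin \o f0) ->
  fp_hat p alpha f0 (- xi) t = conjc (fp_hat p alpha f0 xi t).
Proof.
move=> if0; rewrite !fp_hatE mulNr fourierN// /fp_damping normrN.
by case: (fourier _ _) => ? ? /=; apply/eqP; rewrite eq_complex /= !mulr0 !subr0 !add0r mulNr !eqxx.
Qed.

Lemma normc_conjB (x y : R[i]) : normc (conjc x - conjc y) = normc (x - y).
Proof. by case: x => a b; case: y => c d /=; rewrite -opprD sqrrN. Qed.

End FokkerPlanckScaling.

(** * Passage to the limit *)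

Lemma grazing_support (R : realType) (b : R -> R -> R) (s0 : R) :
  grazing_family b -> 0 < s0 ->
  \forall e \near 0^'+, forall th : R, `[0, pi / 2]%classic th ->
    b e th != 0 -> 0 < sin th < s0.
Proof.
move=> [_ [c [d [c0 supp dto0]]] _] s00.
have [h h0 hs] : exists2 h : R, 0 < h & forall x, 0 < x < h -> `|sin x| < s0.
  apply: at_right0P.
  have sc : sin x @[x --> (0 : R)^'+] --> (0 : R).
    by rewrite -[X in _ --> X]sin0; apply: cvg_at_right_filter; exact: continuous_sin.
  move/cvgrPdist_lt : sc => /(_ _ s00).
  by apply: filterS => x; rewrite sub0r normrN.
near=> e => th Ith bth.
have e0 : 0 < e by [].
have Ath : angles th.
  move: Ith; rewrite /angles /= !in_itv/= => /andP[th0 ->]; rewrite andbT.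
  by apply: le_trans th0; rewrite oppr_le0 divr_ge0 ?pi_ge0.
have [|_ /andP[cth thd]] := supp _ e0 th.
  by apply: subset_closure; split.
move: Ith; rewrite /= in_itv/= => /andP[th0 thpi].
rewrite ger0_norm// in cth thd.
have thgt0 : 0 < th by apply: lt_le_trans cth; exact: c0.
have -> /= : 0 < sin th.
  apply: sin_gt0_pi; rewrite thgt0/=; apply: (le_lt_trans thpi).
  by have := @pi_gt0 R; lra.
apply: (le_lt_trans (ler_norm _)); apply: hs; rewrite thgt0/=.
apply: (le_lt_trans thd); near: e.
exact: (cvgr_lt 0 dto0).
Unshelve. all: by end_near. Qed.

(** The nonnegative element bounds the supremum from below and excludes the value of an empty
    supremum; the upper bounds make it eventually finite and small. *)
Lemma cvg_ereal_sup0 (R : realType) (S : R -> set (\bar R)) :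
  (forall e, exists2 y, S e y & (0 <= y)%E) ->
  (forall om : R, 0 < om -> \forall e \near 0^'+,
    forall y, S e y -> (y <= om%:E)%E) ->
  ereal_sup (S e) @[e --> 0^'+] --> 0%E.
Proof.
move=> S0 Sle.
have sup_ge0 e : (0 <= ereal_sup (S e))%E.
  by have [y Sy y0] := S0 e; apply: (le_trans y0); exact: ereal_sup_ubound.
have sup_le om : 0 < om -> \forall e \near 0^'+, (ereal_sup (S e) <= om%:E)%E.
  by move=> /Sle; apply: filterS => e Se; apply: ge_ereal_sup => y; exact: Se.
apply/fine_cvgP; split.
  have := sup_le 1 ltr01; apply: filterS => e le1.
  by rewrite ge0_fin_numE//; apply: le_lt_trans le1 _; rewrite ltry.
apply/cvgrPdist_le => om om0; have := sup_le om om0; apply: filterS => e le_om.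
rewrite sub0r normrN /= ger0_norm ?fine_ge0//.
rewrite -lee_fin fineK// ge0_fin_numE//.
by apply: le_lt_trans le_om _; rewrite ltry.
Qed.

Theorem theorem5 (R : realType) (p : R) (b : R -> R -> R) (f0 : R -> R)
    (feps : R -> R -> R -> R) (alpha : R) (df0hat : R -> R[i]) (delta : R)
    (hp : 0 < p <= 1)
    (hbL1 : forall e : R, 0 < e ->
      (@lebesgue_measure R).-integrable angles (EFin \o b e))
    (hb : grazing_family b)
    (hf0L1 : (@lebesgue_measure R).-integrable setT (EFin \o f0))
    (hf0_ge0 : forall v : R, 0 <= f0 v)
    (hf0_even : forall v : R, f0 (- v) = f0 v)
    (hf0_mass : (\int[@lebesgue_measure R]_v (f0 v)%:E = 1)%E)
    (hfeps : forall e : R, 0 < e -> kac_solution p (b e) f0 (feps e))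
    (halpha : 0 < alpha)
    (hA : ((1 - fourier f0 xi) / (xi `^ (2 / (p + 1)))%:C : R[i]^o)
            @[xi --> 0^'+] --> (alpha%:C : R[i]^o))
    (hdf0hat : forall xi : R, xi != 0 ->
      has_derivative_in setT (fourier f0) xi (df0hat xi))
    (hdelta : 0 < delta < 1)
    (hB : forall r : R, 0 < r -> exists2 K : R, 0 < K &
      forall xi tau : R, 0 < xi <= r -> 0 < tau <= r -> xi != tau ->
        Normc.normc (df0hat xi / (xi `^ ((1 - p) / (p + 1)))%:C
                     - df0hat tau / (tau `^ ((1 - p) / (p + 1)))%:C)
          / `|xi - tau| `^ delta <= K) :
  ereal_sup [set y | exists t xi : R, [/\ 0 <= t, xi != 0 &
      y = (Normc.normc (fourier (feps e t) xi - fp_hat p alpha f0 xi t)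
             / `|xi| `^ (2 / (p + 1)))%:E]]
    @[e --> 0^'+] --> 0%E.
Proof.
have /andP[p0 p1] := hp; have /andP[de0 _] := hdelta.
set q := 2 / (p + 1).
have q0 : 0 < q by rewrite divr_gt0// addr_gt0.
apply: cvg_ereal_sup0 => [e|om om0].
  exists (Normc.normc (fourier (feps e 0) 1 - fp_hat p alpha f0 1 0)
             / `|1| `^ q)%:E; first by exists 0, 1.
  by rewrite lee_fin divr_ge0 ?normc_ge0 ?powR_ge0.
pose r := (2 / om) `^ q^-1.
have r0 : 0 < r by rewrite powR_gt0 ?divr_gt0.
have rq : r `^ q = 2 / om.
  by rewrite /r -powRrM mulVf ?gt_eqF// powRr1// divr_ge0// ltW.
have f01 : fourier f0 0 = 1.
  by rewrite fourier_at0 /Rintegral hf0_mass.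
have uf0 : unit_bounded (fourier f0).
  by apply: unit_bounded_fourier => //; exact: aeW.
have [_ _ f0le1] := uf0.
have hD x : 0 < x -> has_derivative_in setT (fourier f0) x (df0hat x).
  by move=> x0; apply: hdf0hat; rewrite gt_eqF.
have [s0 s00 hs0] := grazing_residual_pointwise p alpha delta r om (fourier f0) df0hat
  hp halpha de0 r0 om0 f0le1 hA hD (hB _ r0).
near=> e => y [t [xi [t0 xi0 ->]]]; rewrite lee_fin.
have e0 : 0 < e by [].
have bsupp : forall th : R, `[0, pi / 2]%classic th -> b e th != 0 -> 0 < sin th < s0.
  by near: e; exact: grazing_support.
have sub : (`[0, pi / 2]%classic : set R) `<=` angles.
  move=> th; rewrite /angles /= !in_itv/= => /andP[th0 ->]; rewrite andbT.
  by apply: le_trans th0; rewrite oppr_le0 divr_ge0 ?pi_ge0.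
have ib : (@lebesgue_measure R).-integrable `[0, pi / 2] (EFin \o b e).
  apply: (@integrableS _ _ R (@lebesgue_measure R) angles _ _ _ _ sub (hbL1 _ e0)).
    exact: measurable_itv.
  exact: measurable_itv.
have [heven _ hsin] := hb.
have b0 th : `[0, pi / 2]%classic th -> 0 <= b e th.
  by move=> /sub Ath; have [] := heven _ _ e0 Ath.
have sol := hfeps _ e0.
have [C1 fge0 fini fder] := sol.
have ift s : 0 <= s -> (@lebesgue_measure R).-integrable setT (EFin \o feps e s).
  by case: C1 => df /(_ s) h /h [].
have mass := kac_mass p (b e) f0 (feps e) ib b0 hf0L1 f01 sol.
have uphi s : 0 <= s -> unit_bounded (fourier (feps e s)).
  by move=> s0'; apply: unit_bounded_fourier; [exact: ift|exact: fge0|exact: mass].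
have upsi s : 0 <= s -> unit_bounded (fun x => fp_hat p alpha f0 x s).
  by move=> s0'; apply: unit_bounded_fp_hat => //; exact: ltW.
have main x : 0 < x ->
    Normc.normc (fourier (feps e t) x - fp_hat p alpha f0 x t) <= om * x `^ q.
  move=> x0; have [xr|rx] := leP x r; last first.
    apply: (@le_trans _ _ 2).
      apply: (le_trans (normcB_le _ _)).
      have [_ _ /(_ x) ?] := uphi _ t0; have [_ _ /(_ x) ?] := upsi _ t0.
      by rewrite -[leRHS]/(1 + 1); exact: lerD.
    rewrite -ler_pdivrMl// mulrC -rq.
    by apply: ge0_ler_powR; rewrite ?nnegrE ltW.
  (* The Fokker-Planck operator applied to the initial transform; [res] below is its mismatch with
     the Kac operator at the shifted frequency, times the damping. *)
  pose L z := - (2 * alpha * z `^ q)%:C * fourier f0 z - ((p + 1) * z)%:C * df0hat z.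
  pose res s z := (fp_damping p alpha s z)%:C *
    (L (z * fp_shift p s) - kac_rhs p (b e) (fourier f0) (z * fp_shift p s)).
  (* The residual estimate has constant [2 * om], and time integration of [expR (- (2 * t))] halves
     it. *)
  have -> : om = (2 * om) / 2 by rewrite mulrAC divff ?mul1r// pnatr_eq0.
  apply: (kac_stability p r (2 * om) (b e) (fun s => fourier (feps e s))
    (fun s z => fp_hat p alpha f0 z s) res p0 _ ib b0 uphi upsi _ _ _ _ _ t x t0 _).
  - by rewrite mulr_ge0// ltW.
  - move=> s s0'; rewrite mass// fp_hatE mul0r f01 /fp_damping normr0 powR0 ?gt_eqF//.
    by rewrite mulr0 mul0r oppr0 expR0 mulr1.
  - by move=> z; rewrite fp_hat0; apply: fourier_ae_eq => //; exact: ift.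
  - by move=> s z s0' _; exact: fder.
  - move=> s z s0' /andP[z0 zr].
    have -> : kac_rhs p (b e) (fun x => fp_hat p alpha f0 x s) z + res s z =
        (fp_damping p alpha s z)%:C * L (z * fp_shift p s).
      rewrite (kac_rhs_fp_hat p alpha f0 (b e) z s p0 (ltW z0) ib uf0) /res.
      by rewrite -mulrDr [X in _ * X]addrC subrK.
    exact: (fp_hat_derivative p alpha f0 df0hat z s p0 z0 hdf0hat).
  - move=> s z s0' /andP[z0 zr].
    rewrite /res Normc.normcM normc_real ger0_norm ?expR_ge0//.
    set eta := z * fp_shift p s.
    have eta0 : 0 < eta by rewrite mulr_gt0 ?expR_gt0.
    (* The shift never raises the frequency, so the one threshold [s0] serves all times. *)
    have etar : eta <= r.
      apply: le_trans zr; rewrite ler_piMr ?(ltW z0)// -expR0 ler_expR oppr_le0.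
      by rewrite mulr_ge0// addr_ge0// ltW.
    have := grazing_residual p alpha om s0 (b e) (fourier f0) df0hat eta
      ib b0 (hsin _ e0) bsupp uf0 (fun th => hs0 eta th _).
    rewrite eta0 etar => /(_ isT) hres.
    apply: (@le_trans _ _ (1 * (2 * om * eta `^ q))).
      apply: ler_pM => //; rewrite ?expR_ge0 ?normc_ge0//.
      by apply: fp_damping_le1 => //; exact: ltW.
    by rewrite mul1r powR_fp_shift ?(ltW z0)// mulrA.
  - by rewrite x0.
rewrite ler_pdivrMr ?powR_gt0 ?normr_gt0//.
have [xpos|xneg] : 0 < xi \/ xi < 0.
  by move: xi0; rewrite neq_lt => /orP[]; [right|left].
  by rewrite gtr0_norm//; exact: main.
rewrite ltr0_norm//.
(* Negative frequencies reduce to positive ones: transforms of real functions are conjugate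
   symmetric, and conjugation keeps the modulus. *)
have -> : Normc.normc (fourier (feps e t) xi - fp_hat p alpha f0 xi t) =
    Normc.normc (fourier (feps e t) (- xi) - fp_hat p alpha f0 (- xi) t).
  by rewrite (fourierN _ _ (ift _ t0)) (fp_hatN _ _ _ _ _ hf0L1) normc_conjB.
by apply: (main (- xi)); rewrite oppr_gt0.
Unshelve. all: by end_near. Qed.
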